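(* Let $d\ge2$, $L\in\mathbb{N}$, and let $f:[0,1)^d\to[0,\infty)$ be an $L$-piecewise constant probability density. Let $X_1,X_2,\dots$ be i.i.d. with density $f$. Then \[\limsup_{n\to\infty}n^{-1/d}\ell(\{X_1,\dots,X_n\})\le c_d\bar J\quad\text{almost surely.}\]
   Context: $x\leqq y$ means $x_i\le y_i$ for all $i$; $\ell(S)$ is the length of a longest chain (subset totally ordered by $\leqq$) in a finite set $S$. For a multiindex $\alpha$ with integer entries $1\le\alpha_i\le L$, $Q_{L,\alpha}=\{x\in[0,1)^d:\alpha-(1,\dots,1)\leqq Lx<\alpha\}$; $f$ is $L$-piecewise constant if constant on each $Q_{L,\alpha}$. Extend $f$ by $0$ outside $[0,1)^d$. $\mathcal{A}$ is the set of $\gamma\in C^1([0,1];\mathbb{R}^d)$ with all components of $\gamma'(t)$ nonnegative and $\gamma'(t)\ne0$ for every $t$; $J(\gamma)=\int_0^1 f(\gamma(t))^{1/d}(\gamma_1'(t)\cdots\gamma_d'(t))^{1/d}dt$; $\bar J=\sup_{\gamma\in\mathcal{A}}J(\gamma)$. $c_d$ is the positive constant such that, for i.i.d. uniform points on $[0,1]^d$, $n^{-1/d}$ times the length of a longest chain among the first $n$ points converges almost surely to $c_d$. *)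

(* Defs.v *)
From HB Require Import structures.
From mathcomp Require Import all_boot all_order all_algebra.
From mathcomp Require Import all_classical all_reals all_analysis.
Set Implicit Arguments. Unset Strict Implicit. Unset Printing Implicit Defensive.
Import Order.TTheory GRing.Theory Num.Theory.
Import numFieldNormedType.Exports.
Local Open Scope classical_set_scope.
Local Open Scope ring_scope.

Section Defs.
Variables (R : realType) (d : nat).
Notation pt := 'rV[R]_d.

Definition leqv (x y : pt) : bool := [forall i, x ord0 i <= y ord0 i].

Definition ell (s : seq pt) : nat :=
  \max_(I : {set 'I_(size s)} |
          [forall i in I, forall j in I,
             leqv (nth (0%R : pt) s i) (nth (0%R : pt) s j) || leqv (nth (0%R : pt) s j) (nth (0%R : pt) s i)])
    size (undup [seq nth (0%R : pt) s (val i) | i <- enum I]).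

Definition ell_first (T : Type) (X : nat -> T -> pt) (n : nat) (w : T) : nat :=
  ell [seq X i w | i <- iota 0 n].

Definition box (a b : pt) : set pt :=
  [set x | forall i, a ord0 i <= x ord0 i < b ord0 i].
Definition boxvol (a b : pt) : R := \prod_(i < d) Num.max (b ord0 i - a ord0 i) 0.

Definition borel_d : set (set pt) :=
  <<s [set B | exists a b, B = box a b] >>.

(* d-dimensional Lebesgue (outer) measure: infimum of the total volumes of
   countable box covers (it coincides with Lebesgue measure on borel_d) *)
Definition leb_d (A : set pt) : \bar R :=
  ereal_inf [set s | exists a b : nat -> pt,
     A `<=` \bigcup_k box (a k) (b k) /\
     s = (\sum_(0 <= k <oo) (boxvol (a k) (b k))%:E)%E].

Definition unit_cube_ho : set pt := [set x | forall i, 0 <= x ord0 i < 1].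
Definition unit_cube_cl : set pt := [set x | forall i, 0 <= x ord0 i <= 1].

(* the cell Q_{L,alpha}; alpha i : 'I_L stands for the paper's alpha_i - 1 *)
Definition cell (L : nat) (alpha : {ffun 'I_d -> 'I_L}) : set pt :=
  [set x | forall i, 0 <= x ord0 i < 1 /\
      (alpha i)%:R <= L%:R * x ord0 i < (alpha i)%:R + 1].

Definition piecewise_const (L : nat) (f : pt -> R) : Prop :=
  forall (alpha : {ffun 'I_d -> 'I_L}) x y, cell alpha x -> cell alpha y -> f x = f y.

Definition corner (L : nat) (alpha : {ffun 'I_d -> 'I_L}) : pt :=
  \row_i ((alpha i)%:R / L%:R).

(* \int_A f d(lambda^d) for an L-piecewise constant f vanishing outside
   [0,1)^d, i.e. the integral of the simple function sum_alpha c_alpha 1_{Q_alpha} *)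
Definition pc_integral (L : nat) (f : pt -> R) (A : set pt) : \bar R :=
  (\sum_(alpha : {ffun 'I_d -> 'I_L})
      (f (corner alpha))%:E * leb_d (A `&` cell alpha))%E.

Definition iid_law (dT : measure_display) (T : measurableType dT)
  (P : probability T R) (X : nat -> T -> pt) (mu : set pt -> \bar R) : Prop :=
  [/\ (forall i A, borel_d A -> measurable (X i @^-1` A)),
      (forall (S : seq nat) (A : nat -> set pt), uniq S ->
         (forall i, borel_d (A i)) ->
         P (\bigcap_(i in [set` S]) (X i @^-1` A i)) =
         (\prod_(i <- S) P (X i @^-1` A i))%E) &
      (forall i A, borel_d A -> P (X i @^-1` A) = mu A)].

Definition uniform_law (A : set pt) : \bar R := leb_d (A `&` unit_cube_cl).

Definition scaled_chain (T : Type) (X : nat -> T -> pt) (w : T) (n : nat) : R :=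
  (n%:R `^ (- (d%:R)^-1)) * (ell_first X n w)%:R.

Definition is_cd (c : R) : Prop :=
  forall (dT : measure_display) (T : measurableType dT) (P : probability T R)
         (U : nat -> T -> pt),
    iid_law P U uniform_law ->
    {ae P, forall w, scaled_chain U w @ \oo --> c}.

Definition admissible (g : 'I_d -> R -> R) : Prop :=
  [/\ (forall i t, t \in `[0, 1] -> derivable (g i) t 1),
      (forall i, {within `[0, 1], continuous (derive1 (g i))}) &
      (forall t, t \in `[0, 1] ->
         (forall i, 0 <= derive1 (g i) t) /\ exists i, derive1 (g i) t != 0)].

Definition Jfun (f : pt -> R) (g : 'I_d -> R -> R) : \bar R :=
  (\int[lebesgue_measure]_(t in `[0%R, 1%R])
     ((f (\row_i g i t)) `^ (d%:R^-1) *
      (\prod_(i < d) derive1 (g i) t) `^ (d%:R^-1))%:E)%E.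

Definition Jbar (f : pt -> R) : \bar R :=
  ereal_sup [set Jfun f g | g in admissible].

End Defs.

(* Main.v *)
(* A chain visits the cells Q_alpha in increasing order of alpha, so it splits
   into one piece per visited cell.  Each piece lies between its least and its
   greatest point, hence in one of finitely many boxes with corners on a fine
   grid refining the cells.  In a box B inside Q_alpha the sample points,
   rescaled, are i.i.d. uniform, and about n f_alpha vol(B) of them occur among
   the first n; so n^(-1/d) times the longest chain in B is at most
   c_d (f_alpha vol B)^(1/d) + o(1) almost surely.  The boxes of one chain are
   successive up to one grid step, and up to the grid error the sum of the
   (f_alpha vol B)^(1/d) is approximated by J of a C^1 curve crossing them in
   turn, because (prod_i gamma_i')^(1/d) integrates to (vol B)^(1/d) along the
   diagonal of B.

   Two devices avoid measure-theoretic constructions.  The uniform points are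
   obtained on the original probability space, as the successive points falling
   in B.  The number of hits is controlled by a Chernoff bound and Borel-Cantelli
   instead of the strong law of large numbers. *)
Require Import Defs.
From HB Require Import structures.
From mathcomp Require Import all_boot all_order all_algebra.
From mathcomp Require Import all_classical all_reals all_analysis.
From mathcomp Require Import measurable_realfun zify ring lra.
Set Implicit Arguments. Unset Strict Implicit. Unset Printing Implicit Defensive.
Import Order.TTheory GRing.Theory Num.Theory.
Import numFieldNormedType.Exports.
Local Open Scope classical_set_scope.
Local Open Scope ring_scope.

(** * Chains *)

Section Chains.
Variables (R : realType) (d : nat).
Notation pt := 'rV[R]_d.
Implicit Types (x y z : pt) (s t : seq pt).

(** The boxes holding the pieces of a chain are not quite successive: in a coordinate where the last
    point of a piece and the first point of the next share a grid interval, the first box ends after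
    the second begins. So each piece gets two boxes. The larger, extended to the next grid line,
    counts the points; the smaller, without that layer, is crossed by the curve. The lost volume is
    of the order of the mesh, its d-th root is paid once per cell, and the number of cells is
    bounded independently of n; so the mesh can be fixed before n grows.

    An admissible curve must never stop, and must run inside half-open cells to see the right value
    of f. Diagonals smoothed at the corners do stop there. A small linear drift cures this, at the
    price of giving up the end of each diagonal, so J only approaches the sum of the roots; this
    suffices because [Jbar] is a supremum.

    [leb_d] is only an infimum over covers. It scales exactly under dilations, which leaves one
    unknown, its value on the unit cube, and the existence of the sample determines that value.
    Likewise [is_cd] yields nothing, not even the sign of c, until a uniform sample is exhibited. *)

Definition chain t := {in t &, forall x y, leqv x y || leqv y x}.

Lemma leqv_refl x : leqv x x.
Proof. exact/forallP. Qed.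

Lemma leqv_trans y x z : leqv x y -> leqv y z -> leqv x z.
Proof.
move=> /forallP xy /forallP yz; apply/forallP => i; exact: le_trans (xy i) (yz i).
Qed.

Lemma leqv_anti x y : leqv x y -> leqv y x -> x = y.
Proof.
move=> /forallP xy /forallP yx; apply/rowP => i.
by apply/eqP; rewrite eq_le xy yx.
Qed.

Lemma ell_witness s :
  exists t, [/\ uniq t, {subset t <= s}, chain t & size t = ell s].
Proof.
rewrite /ell; set P := (X in \max_(I | X I) _).
have P0 : P finset.set0.
  by apply/forallP => i; rewrite finset.in_set0.
have [I PI ->] : {I | P I & \max_(I | P I) size (undup
    [seq nth (0%R : pt) s (val i) | i <- enum I]) = size (undup
    [seq nth (0%R : pt) s (val i) | i <- enum I])}.
  by apply: eq_bigmax_cond; apply/card_gt0P; exists finset.set0.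
exists (undup [seq nth (0%R : pt) s (val i) | i <- enum I]); split=> //.
- exact: undup_uniq.
- by move=> x; rewrite mem_undup => /mapP[i _ ->]; apply: mem_nth; apply: ltn_ord.
- move=> x y; rewrite !mem_undup => /mapP[i iI ->] /mapP[j jI ->].
  rewrite !mem_enum in iI jI.
  by move/forallP: PI => /(_ i); rewrite iI /= => /forallP/(_ j); rewrite jI.
Qed.

Lemma chain_le_ell s t :
  uniq t -> {subset t <= s} -> chain t -> (size t <= ell s)%N.
Proof.
move=> ut ts ct.
pose I := [set i : 'I_(size s) | nth 0 s i \in t]%SET.
have PI : [forall i in I, forall j in I,
    leqv (nth (0%R : pt) s i) (nth (0%R : pt) s j) ||
    leqv (nth (0%R : pt) s j) (nth (0%R : pt) s i)].
  apply/'forall_implyP => i iI; apply/'forall_implyP => j jI.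
  by apply: ct; [move: iI|move: jI]; rewrite inE.
apply: leq_trans (leq_bigmax_cond _ PI).
apply: uniq_leq_size => // x xt; rewrite mem_undup.
have xs : (index x s < size s)%N by rewrite index_mem ts.
apply/mapP; exists (Ordinal xs); last by rewrite /= nth_index ?ts.
by rewrite mem_enum inE /= nth_index ?ts.
Qed.

Lemma ell_le_size s : (ell s <= size s)%N.
Proof. by have [t [ut ts _ <-]] := ell_witness s; apply: uniq_leq_size. Qed.

Lemma ell_map_ge (phi : pt -> pt) s :
  (forall x y, leqv (phi x) (phi y) = leqv x y) -> (ell s <= ell (map phi s))%N.
Proof.
move=> phiE; have [t [ut ts ct <-]] := ell_witness s.
have phi_inj : injective phi.
  by move=> x y xy; apply: leqv_anti; rewrite -phiE xy leqv_refl.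
rewrite -(size_map phi); apply: chain_le_ell.
- by rewrite map_inj_uniq.
- by move=> _ /mapP[x xt ->]; apply: map_f; apply: ts.
- by move=> _ _ /mapP[x xt ->] /mapP[y yt ->]; rewrite !phiE; apply: ct.
Qed.

Lemma chain_min t : chain t -> t != [::] ->
  exists2 m, m \in t & {in t, forall x, leqv m x}.
Proof.
elim: t => // x t IH ct _; have [->|t0] := eqVneq t [::].
  by exists x; [rewrite mem_head | move=> y; rewrite inE => /eqP->; exact: leqv_refl].
have [|m mt mP] := IH _ t0; first by move=> a b aI bI; apply: ct; rewrite inE ?aI ?bI orbT.
have /orP[xm|mx] := ct x m (mem_head _ _) (mem_behead (s := x :: t) mt).
- exists x; rewrite ?mem_head// => y; rewrite inE => /predU1P[->|/mP]; first exact: leqv_refl.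
  exact: leqv_trans xm.
- by exists m; rewrite ?inE ?mt ?orbT// => y; rewrite inE => /predU1P[->//|/mP].
Qed.

Lemma chain_max t : chain t -> t != [::] ->
  exists2 m, m \in t & {in t, forall x, leqv x m}.
Proof.
elim: t => // x t IH ct _; have [->|t0] := eqVneq t [::].
  by exists x; [rewrite mem_head | move=> y; rewrite inE => /eqP->; exact: leqv_refl].
have [|m mt mP] := IH _ t0; first by move=> a b aI bI; apply: ct; rewrite inE ?aI ?bI orbT.
have /orP[xm|mx] := ct x m (mem_head _ _) (mem_behead (s := x :: t) mt).
- by exists m; rewrite ?inE ?mt ?orbT// => y; rewrite inE => /predU1P[->//|/mP].
- exists x; rewrite ?mem_head// => y; rewrite inE => /predU1P[->|/mP ym]; first exact: leqv_refl.
  exact: leqv_trans mx.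
Qed.

End Chains.

(** * Curves through a sequence of boxes *)

Section SmoothStep.
Variable R : realType.
Implicit Types u v x t : R.

(** The truncated square, whose shifted combinations are C^1 quadratic splines. *)
Definition sqpos u : R := Num.max u 0 ^+ 2.

Lemma is_derive_sqpos u : is_derive u 1 sqpos (2 * Num.max u 0).
Proof.
have [u0|u0|->] := ltgtP u 0.
- rewrite mulr0; apply: (@near_eq_is_derive _ _ _ (cst 0)).
  near=> x; rewrite /sqpos max_r ?expr0n//.
  by near: x; exact: lt_le_nbhsl.
- apply: (@near_eq_is_derive _ _ _ (fun x => x ^+ 2)).
    near=> x; rewrite /sqpos max_l//.
    by near: x; exact: lt_le_nbhsr.
  by apply: is_derive_eq; rewrite /GRing.scale/=; ring.
- rewrite mulr0.
  have H : (fun h : R => h^-1 *: (sqpos (h *: 1 + 0) - sqpos 0)) @ 0^' --> (0 : R).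
    apply/cvgr0Pnorm_lt => e e0; near=> h.
    have h0 : h != 0 by near: h; exact: nbhs_dnbhs_neq.
    have he : `|h| < e by near: h; apply: dnbhs0_lt.
    rewrite {2}/sqpos maxxx expr0n subr0 addr0 /GRing.scale/= mulr1 normrM normfV.
    rewrite ltr_pdivrMl ?normr_gt0// /sqpos; apply: le_lt_trans (_ : `|h| * `|h| < _).
      rewrite -normrM -expr2 !ger0_norm ?sqr_ge0//.
      by case: (leP h 0) => h1; rewrite ?expr0n ?sqr_ge0.
    by rewrite ltr_pM2l ?normr_gt0.
  by split; [apply: cvgP H | apply: cvg_lim H].
Unshelve. all: by end_near. Qed.

(* A C^1 step from 0 to 1; its derivative [tent] is supported by [0, 1]. *)
Definition smstep u : R := 2 * (sqpos u - 2 * sqpos (u - 2^-1) + sqpos (u - 1)).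
Definition tent u : R :=
  4 * (Num.max u 0 - 2 * Num.max (u - 2^-1) 0 + Num.max (u - 1) 0).

Lemma is_derive_smstep u : is_derive u 1 smstep (tent u).
Proof.
have S a : is_derive u 1 (fun x => sqpos (x - a)) (2 * Num.max (u - a) 0).
  have D1 := is_derive_sqpos (u - a).
  have D2 : is_derive u 1 (fun x : R => x - a) 1.
    by apply: is_derive_eq; rewrite subr0.
  by have := @is_derive1_comp _ _ (fun x : R => x - a) _ _ _ D1 D2; rewrite mulr1.
have D0 := is_derive_sqpos u.
have D1 := S 2^-1; have D2 := S 1.
rewrite /smstep /tent; apply: is_derive_eq; rewrite /GRing.scale/=.
ring.
Qed.

Lemma tent_ge0 u : 0 <= tent u.
Proof.
rewrite /tent; case: (leP u 0) => h1; case: (leP (u - 2^-1) 0) => h2;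
  case: (leP (u - 1) 0) => h3; lra.
Qed.

Lemma smstep_le0 u : u <= 0 -> smstep u = 0.
Proof.
move=> u0; rewrite /smstep /sqpos !max_r//; first by rewrite expr0n/=; ring.
all: lra.
Qed.

Lemma smstep_ge1 u : 1 <= u -> smstep u = 1.
Proof. by move=> u1; rewrite /smstep /sqpos !max_l; [field|lra..]. Qed.

Lemma smstep_ge0 u : 0 <= smstep u.
Proof.
rewrite /smstep /sqpos; case: (leP u 0) => h1; case: (leP (u - 2^-1) 0) => h2;
  case: (leP (u - 1) 0) => h3; nra.
Qed.

(** The bound is the value at [v], so this is monotonicity in explicit form. Stopping at time [v]
    leaves the fraction 2 (1 - v)^2 of the step ahead, which is the room for the drift of the
    curve. *)
Lemma smstep_le u v : 2^-1 <= v -> v <= 1 -> u <= v ->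
  smstep u <= 1 - 2 * (1 - v) ^+ 2.
Proof.
move=> v1 v2 uv; rewrite /smstep /sqpos; case: (leP u 0) => h1;
 case: (leP (u - 2^-1) 0) => h2; case: (leP (u - 1) 0) => h3; nra.
Qed.

Lemma smstep_at v : 2^-1 <= v -> v <= 1 -> smstep v = 1 - 2 * (1 - v) ^+ 2.
Proof.
move=> v1 v2; rewrite /smstep /sqpos.
have -> : Num.max v 0 = v by apply: max_l; lra.
have -> : Num.max (v - 2^-1) 0 = v - 2^-1 by apply: max_l; lra.
have -> : Num.max (v - 1) 0 = 0 by apply: max_r; lra.
by rewrite expr0n/=; field.
Qed.

Lemma continuous_tent : continuous tent.
Proof.
have C a : continuous (fun x : R => Num.max (x - a) 0).
  move=> x; apply: (@continuous_max _ _ (fun x => x - a) (cst 0)).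
    by apply: cvgB; [exact: cvg_id|exact: cvg_cst].
  exact: cvg_cst.
have C0 : continuous (fun x : R => Num.max x 0).
  move=> x; apply: (@continuous_max _ _ (fun x => x) (cst 0)).
    exact: cvg_id.
  exact: cvg_cst.
move=> x; rewrite /tent; apply: cvgM; first exact: cvg_cst.
apply: cvgD; last exact: C.
by apply: cvgB; [exact: C0 | apply: cvgM; [exact: cvg_cst|exact: C]].
Qed.

End SmoothStep.

Section IntegralLowerBound.
Local Open Scope ereal_scope.

(* Unlike [ge0_le_integral], no measurability of the larger function. *)
Lemma le_integral_nonmeasurable d (T : measurableType d) (R : realType)
  (mu : {measure set T -> \bar R}) (D : set T) (f1 f2 : T -> \bar R) :
  (forall x, D x -> 0 <= f1 x) -> (forall x, D x -> f1 x <= f2 x) ->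
  \int[mu]_(x in D) f1 x <= \int[mu]_(x in D) f2 x.
Proof.
move=> f10 f12; rewrite !ge0_integralE//; last first.
  by move=> x Dx; apply: le_trans (f12 _ Dx); exact: f10.
apply: le_ereal_sup => _ [h hf <-]; exists h => // x.
by apply: le_trans (hf x) _; apply: lee_restrict.
Qed.

End IntegralLowerBound.

Lemma powR_inv_exp (R : realType) (n : nat) (x : R) : (0 < n)%N -> 0 <= x ->
  (x ^+ n) `^ n%:R^-1 = x.
Proof.
move=> n0 x0; rewrite -powR_mulrn// -powRrM mulfV ?powRr1//.
by rewrite pnatr_eq0 -lt0n.
Qed.

Lemma ler_powR_inv (R : realType) (n : nat) (x y : R) : 0 <= x -> x <= y ->
  x `^ n%:R^-1 <= y `^ n%:R^-1.
Proof.
move=> x0 xy.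
by apply: ge0_ler_powR; rewrite ?nnegrE ?invr_ge0 ?ler0n//; exact: le_trans xy.
Qed.

Lemma finite_gt0_lb (R : realType) (I : finType) (g : I -> R) :
  exists2 e, 0 < e & forall i, 0 < g i -> e <= g i.
Proof.
exists (\big[Num.min/1]_(i | 0 < g i) g i).
  by elim/big_ind: _ => // x y x0 y0; rewrite lt_min x0.
by move=> i gi; apply: bigmin_le_cond.
Qed.

Section Curve.
Variables (R : realType) (d m : nat) (lo hi : nat -> 'I_d -> R) (delta : R).

Let N : R := (2 * m)%:R.

(** In the clock N t, the unit slot starting at 2k runs along the diagonal of the k-th box, and the
    slot starting at 2k+1 joins its upper corner to the next lower corner. All coordinates share the
    clock, so on a diagonal their derivatives are, up to the drift, proportional to one [tent]. The
    drift [delta * t] keeps every derivative positive where the steps are at rest. *)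
Definition curve (i : 'I_d) (t : R) : R :=
  lo 0 i + \sum_(k < m) ((hi k i - lo k i) * smstep (N * t - (2 * k)%:R)
    + (lo k.+1 i - hi k i) * smstep (N * t - (2 * k).+1%:R)) + delta * t.

Definition dcurve (i : 'I_d) (t : R) : R :=
  \sum_(k < m) ((hi k i - lo k i) * (N * tent (N * t - (2 * k)%:R))
    + (lo k.+1 i - hi k i) * (N * tent (N * t - (2 * k).+1%:R))) + delta.

Lemma is_derive_smstep_affine (a t : R) :
  is_derive t 1 (fun x => smstep (N * x - a)) (N * tent (N * t - a)).
Proof.
have D1 := is_derive_smstep (N * t - a).
have D2 : is_derive t 1 (fun x : R => N * x - a) N.
  by apply: is_derive_eq; rewrite /GRing.scale/=; ring.
have := @is_derive1_comp _ _ (fun x : R => N * x - a) _ _ _ D1 D2.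
by rewrite mulrC.
Qed.

Lemma is_derive_curve i (t : R) : is_derive t 1 (curve i) (dcurve i t).
Proof.
have D k := is_derive_smstep_affine k t.
pose h (k : 'I_m) (t : R) := (hi k i - lo k i) * smstep (N * t - (2 * k)%:R)
    + (lo k.+1 i - hi k i) * smstep (N * t - (2 * k).+1%:R).
pose dh (k : 'I_m) := (hi k i - lo k i) * (N * tent (N * t - (2 * k)%:R))
    + (lo k.+1 i - hi k i) * (N * tent (N * t - (2 * k).+1%:R)).
have Dh k : is_derive t 1 (h k) (dh k).
  have Da := D (2 * k)%:R; have Db := D (2 * k).+1%:R.
  by rewrite /h; apply: is_derive_eq; rewrite /GRing.scale/= /dh; ring.
have D1 : is_derive t 1 (\sum_(k < m) h k) (\sum_(k < m) dh k).
  exact: is_derive_sum.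
have E : curve i = cst (lo 0 i) + (\sum_(k < m) h k) + (fun x => delta * x).
  by apply/funext => x; rewrite /curve /= !fctE fct_sumE.
have D3 : is_derive t 1 (fun x : R => delta * x) delta.
  by apply: is_derive_eq; rewrite /GRing.scale/=; ring.
by rewrite E /dcurve; apply: is_derive_eq; rewrite add0r.
Qed.

Lemma derive1_curve i (t : R) : derive1 (curve i) t = dcurve i t.
Proof. by rewrite derive1E; have [_ ->] := is_derive_curve i t. Qed.

Lemma curve_on_segment i (t : R) (k : nat) : (k < m)%N ->
  (2 * k)%:R <= N * t <= (2 * k).+1%:R ->
  curve i t = lo k i + (hi k i - lo k i) * smstep (N * t - (2 * k)%:R) + delta * t.
Proof.
move=> km /andP[t1 t2]; rewrite /curve; congr (_ + _).
pose F k := (hi k i - lo k i) * smstep (N * t - (2 * k)%:R)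
    + (lo k.+1 i - hi k i) * smstep (N * t - (2 * k).+1%:R).
rewrite -(big_mkord xpredT F) (big_cat_nat (n := k)) ?(ltnW km)//=.
rewrite [X in _ + (_ + X)]big_ltn//.
have -> : \sum_(k.+1 <= j < m) F j = 0.
  rewrite big_nat_cond big1// => j /andP[/andP[j1 j2] _].
  have : (2 * k).+1%:R <= (2 * j)%:R :> R by rewrite ler_nat; lia.
  have : (2 * j)%:R <= (2 * j).+1%:R :> R by rewrite ler_nat.
  by move=> h1 h2; rewrite /F !smstep_le0 ?mulr0 ?addr0//; lra.
rewrite addr0 {2}/F.
rewrite (smstep_le0 (u := N * t - (2 * k).+1%:R)) ?mulr0 ?addr0; last lra.
rewrite addrA; congr (_ + _).
(* The earlier steps are complete, so their increments telescope from [lo 0] to [lo k]. *)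
rewrite (eq_big_nat _ _ (F1 := F) (F2 := fun j => lo j.+1 i - lo j i)); last first.
  move=> j /andP[_ jk].
  have : (2 * j).+2%:R <= (2 * k)%:R :> R by rewrite ler_nat; lia.
  rewrite -!natr1 => h.
  by rewrite /F !smstep_ge1; [ring|lra..].
by rewrite telescope_sumr// addrC subrK.
Qed.

Hypothesis lohi : forall k i, (k < m)%N -> lo k i <= hi k i.
Hypothesis hilo : forall k i, (k < m)%N -> hi k i <= lo k.+1 i.
Hypothesis delta_gt0 : 0 < delta.

Lemma dcurve_ge i (t : R) (k : 'I_m) :
  (hi k i - lo k i) * (N * tent (N * t - (2 * k)%:R)) + delta <= dcurve i t.
Proof.
rewrite /dcurve lerD2r (bigD1 k)//= -addrA lerDl addr_ge0//.
  by rewrite mulr_ge0 ?subr_ge0 ?hilo// mulr_ge0 ?tent_ge0// ler0n.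
apply: sumr_ge0 => j _; rewrite addr_ge0// mulr_ge0 ?subr_ge0 ?hilo ?lohi//.
  by rewrite mulr_ge0 ?tent_ge0// ler0n.
by rewrite mulr_ge0 ?tent_ge0// ler0n.
Qed.

Lemma dcurve_gt0 i (t : R) : 0 < dcurve i t.
Proof.
rewrite /dcurve ltr_wpDl//.
apply: sumr_ge0 => j _; rewrite addr_ge0// mulr_ge0 ?subr_ge0 ?hilo ?lohi//.
  by rewrite mulr_ge0 ?tent_ge0// ler0n.
by rewrite mulr_ge0 ?tent_ge0// ler0n.
Qed.

Lemma curve_admissible : (0 < d)%N -> admissible curve.
Proof.
move=> d0; split.
- by move=> i t _; have [] := is_derive_curve i t.
- move=> i; apply: continuous_subspaceT.
  have -> : derive1 (curve i) = dcurve i by apply/funext => t; exact: derive1_curve.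
  have C a : continuous (fun x : R => N * tent (N * x - a)).
    move=> x; apply: cvgM; first exact: cvg_cst.
    apply: (@continuous_comp _ _ _ (fun x => N * x - a) (@tent R)); last exact: continuous_tent.
    by apply: cvgB; [apply: cvgM; [exact: cvg_cst|exact: cvg_id]|exact: cvg_cst].
  move=> x; apply: cvgD; last exact: cvg_cst.
  apply: cvg_big => [|k _]; first exact: add_continuous.
  by apply: cvgD; (apply: cvgM; [exact: cvg_cst|exact: C]).
- move=> t _; split=> [i|]; first by rewrite derive1_curve ltW ?dcurve_gt0.
  by exists (Ordinal d0); rewrite derive1_curve gt_eqF ?dcurve_gt0.
Qed.

End Curve.

(** * Lower bounds for [Jbar] from sequences of boxes *)

Section PathBound.
Variables (R : realType) (d L : nat) (f : 'rV[R]_d -> R).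
Hypotheses (d_gt0 : (0 < d)%N) (L_gt0 : (0 < L)%N).
Hypotheses (f_ge0 : forall x, 0 <= f x) (f_pc : piecewise_const L f).

Lemma cell_corner (alpha : {ffun 'I_d -> 'I_L}) : cell alpha (corner R alpha).
Proof.
move=> i; rewrite mxE; have L0 : 0 < L%:R :> R by rewrite ltr0n.
have aL : (alpha i)%:R < L%:R :> R by rewrite ltr_nat.
rewrite divr_ge0 ?ler0n// ltr_pdivrMr// mul1r aL; split=> //.
by rewrite mulrC divfK ?gt_eqF// lexx ltrDl ltr01.
Qed.

Lemma cell_between (alpha : {ffun 'I_d -> 'I_L}) (x : 'rV[R]_d) :
  (forall i, (alpha i)%:R / L%:R <= x ord0 i < ((alpha i)%:R + 1) / L%:R) ->
  cell alpha x.
Proof.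
have L0 : 0 < L%:R :> R by rewrite ltr0n.
move=> xP i; have /andP[x1 x2] := xP i.
have aL : (alpha i)%:R + 1 <= L%:R :> R by rewrite natr1 ler_nat.
rewrite ler_pdivrMr// in x1; rewrite ltr_pdivlMr// in x2.
rewrite ![L%:R * _]mulrC x1 x2; split=> //.
rewrite -(pmulr_lge0 _ L0) (le_trans _ x1) ?ler0n//=.
by rewrite -(ltr_pM2r L0) mul1r (lt_le_trans x2).
Qed.

Section FixedPath.
Variables (m : nat) (al : nat -> {ffun 'I_d -> 'I_L}) (lo hi : nat -> 'I_d -> R).
Hypothesis lohi : forall k i, (k < m)%N -> lo k i <= hi k i.
Hypothesis hilo : forall k i, (k < m)%N -> hi k i <= lo k.+1 i.
Hypothesis al_lo : forall k i, (k < m)%N -> (al k i)%:R / L%:R <= lo k i.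
Hypothesis hi_al : forall k i, (k < m)%N -> hi k i <= ((al k i)%:R + 1) / L%:R.

Let C k := (f (corner R (al k)) * \prod_i (hi k i - lo k i)) `^ d%:R^-1.
Let N : R := (2 * m)%:R.

Let C_ge0 k : 0 <= C k. Proof. exact: powR_ge0. Qed.

(** On the diagonal slot each derivative is at least the width of the box times one common factor;
    the d-th root of the product releases that factor to the first power. *)
Lemma curve_integrand_ge (delta theta t : R) (k : nat) : (k < m)%N ->
  0 < delta -> 2^-1 <= theta < 1 ->
  (forall i, 0 < hi k i - lo k i -> delta < 2 * (1 - theta) ^+ 2 * (hi k i - lo k i)) ->
  0 <= t <= 1 -> (2 * k)%:R <= N * t <= (2 * k)%:R + theta ->
  C k * (N * tent (N * t - (2 * k)%:R)) <=
  f (\row_i curve m lo hi delta i t) `^ d%:R^-1 *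
  (\prod_(i < d) derive1 (curve m lo hi delta i) t) `^ d%:R^-1.
Proof.
move=> km delta0 /andP[th1 th2] deltaP /andP[t0 t1] /andP[Nt1 Nt2].
have tent0 : 0 <= N * tent (N * t - (2 * k)%:R).
  by rewrite mulr_ge0 ?tent_ge0// ler0n.
have dn0 : d%:R^-1 != 0 :> R by rewrite invr_eq0 pnatr_eq0 -lt0n.
(* A box with a side of length 0 has [C k = 0]; the curve may then leave the cell, since only
   nonnegativity is claimed. *)
have [/forallP Dpos|/forallPn[i Di]] := boolP [forall i, 0 < hi k i - lo k i]; last first.
  have Di0 : hi k i - lo k i = 0.
    by apply/eqP; rewrite eq_le subr_ge0 lohi// andbT leNgt.
  rewrite /C (bigD1 i)//= Di0 mul0r mulr0 powR0// mul0r.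
  by rewrite mulr_ge0// powR_ge0.
(* Up to time [theta] each coordinate still misses at least 2 (1 - theta)^2 of its width, more than
   the drift can add, so the curve is strictly below the upper faces of the cell. *)
have -> : f (\row_i curve m lo hi delta i t) = f (corner R (al k)).
  apply: f_pc (cell_corner _); apply: cell_between => i; rewrite mxE.
  rewrite (curve_on_segment lo hi delta i km) /=; last first.
    by rewrite Nt1 -natr1; apply: le_trans Nt2 _; rewrite lerD2l ltW.
  have S1 := smstep_ge0 (N * t - (2 * k)%:R).
  have S2 : smstep (N * t - (2 * k)%:R) <= 1 - 2 * (1 - theta) ^+ 2.
    by apply: smstep_le => //; [exact: ltW|lra].
  have := al_lo i km; have := hi_al i km; have := Dpos i; have := deltaP i (Dpos i).
  move: S1 S2; rewrite /N; move: (smstep _) ((1 - theta) ^+ 2) => s q.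
  move: (_ / L%:R) (_ / L%:R) => b a s0 s1 h1 h2 h3 h4.
  have h5 : 0 <= (hi k i - lo k i) * s by rewrite mulr_ge0// ltW.
  have h6 : (hi k i - lo k i) * s <= (hi k i - lo k i) * (1 - 2 * q).
    by rewrite ler_pM2l; [exact: s1|exact: h2].
  have h7 : 0 <= delta * t by rewrite mulr_ge0// ltW.
  have h8 : delta * t <= delta by rewrite ler_piMr// ltW.
  by apply/andP; split; nra.
rewrite /C powRM ?f_ge0//; last by apply: prodr_ge0 => i _; apply: ltW; apply: Dpos.
rewrite -mulrA; apply: ler_wpM2l; first exact: powR_ge0.
rewrite -[X in _ * X](powR_inv_exp d_gt0 tent0) -powRM; first last.
- exact: exprn_ge0.
- by apply: prodr_ge0 => i _; apply: ltW; apply: Dpos.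
have -> : (\prod_(i < d) (hi k i - lo k i)) * (N * tent (N * t - (2 * k)%:R)) ^+ d
    = \prod_(i < d) ((hi k i - lo k i) * (N * tent (N * t - (2 * k)%:R))).
  by rewrite big_split/= prodr_const card_ord.
apply: ler_powR_inv.
  by apply: prodr_ge0 => i _; rewrite mulr_ge0// ltW// Dpos.
apply: ler_prod => i _; rewrite mulr_ge0//=; last by rewrite ltW// Dpos.
rewrite derive1_curve; apply: le_trans (dcurve_ge delta lohi hilo i t (Ordinal km)).
by rewrite lerDl ltW.
Qed.

(** Only the initial fraction [theta] of each diagonal slot is counted; there the tent integrates to
    [smstep theta], which is the prefactor. *)
Lemma path_Jfun_ge (theta : R) : 2^-1 <= theta < 1 ->
  exists2 g, admissible g &
  (((1 - 2 * (1 - theta) ^+ 2) * \sum_(k < m) C k)%:E <= Jfun f g)%E.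
Proof.
move=> th; have /andP[th1 th2] := th.
have [e e0 eP] := finite_gt0_lb (fun ki : 'I_m * 'I_d => hi ki.1 ki.2 - lo ki.1 ki.2).
(* Half of the drift allowed by the smallest positive width, so that the required inequality is
   strict. *)
pose delta := (1 - theta) ^+ 2 * e.
have th0 : 0 < (1 - theta) ^+ 2 by rewrite exprn_gt0// subr_gt0.
have delta0 : 0 < delta by rewrite mulr_gt0.
exists (curve m lo hi delta); first exact: curve_admissible.
pose g k t := C k * (N * tent (N * t - (2 * k)%:R)).
pose I k := `[(2 * k)%:R / N, ((2 * k)%:R + theta) / N]%classic.
have N_gt0 k : (k < m)%N -> 0 < N by rewrite ltr0n; lia.
have IP (k : 'I_m) t : I k t -> (2 * k)%:R <= N * t <= (2 * k)%:R + theta.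
  rewrite /I /= in_itv/= ler_pdivrMr ?(N_gt0 _ (ltn_ord k))// ler_pdivlMr ?(N_gt0 _ (ltn_ord k))//.
  by rewrite mulrC.
have I01 (k : 'I_m) : I k `<=` `[0, 1].
  move=> t /IP /andP[t1 t2]; rewrite /= in_itv/=.
  have k0 : 0 <= (2 * k)%:R :> R by rewrite ler0n.
  have kN : (2 * k)%:R + 2 <= N :> R.
    by rewrite -natrD ler_nat; have := ltn_ord k; lia.
  have N0 := N_gt0 _ (ltn_ord k).
  rewrite -(pmulr_rge0 _ N0) (le_trans k0)//= -(ler_pM2l N0) mulr1.
  by apply: le_trans t2 _; apply: le_trans kN; rewrite lerD2l; lra.
have g0 (k : 'I_m) t : 0 <= g k t.
  by rewrite /g mulr_ge0// mulr_ge0 ?tent_ge0// ler0n.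
have gcont (k : 'I_m) : continuous (g k).
  move=> x; apply: cvgM; first exact: cvg_cst.
  apply: cvgM; first exact: cvg_cst.
  apply: (@continuous_comp _ _ _ (fun x => N * x - (2 * k)%:R) (@tent R)); last exact: continuous_tent.
  by apply: cvgB; [apply: cvgM; [exact: cvg_cst|exact: cvg_id]|exact: cvg_cst].
have gint (k : 'I_m) : (\int[lebesgue_measure]_(t in I k) (g k t)%:E =
    (C k * (1 - 2 * (1 - theta) ^+ 2))%:E)%E.
  have N0 := N_gt0 _ (ltn_ord k).
  have D (t : R) : is_derive t 1 (fun x => C k * smstep (N * x - (2 * k)%:R)) (g k t).
    have D1 := is_derive_smstep_affine m (2 * k)%:R t.
    by apply: is_derive_eq; rewrite /GRing.scale/= /g /N; ring.
  have Fc : continuous (fun x => C k * smstep (N * x - (2 * k)%:R)).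
    move=> x; apply: (@differentiable_continuous R R^o R^o).
    by apply/derivable1_diffP; have [] := D x.
  rewrite /I (@continuous_FTC2 _ _ (fun x => C k * smstep (N * x - (2 * k)%:R))).
  - rewrite -EFinB ![N * (_ / N)]mulrC !divfK ?gt_eqF// subrr addrAC subrr add0r.
    by rewrite (smstep_le0 (lexx 0)) mulr0 subr0 smstep_at// ltW.
  - by rewrite ltr_pM2r ?invr_gt0// ltrDl (lt_le_trans _ th1)// invr_gt0.
  - exact: continuous_subspaceT.
  - split.
    + by move=> x _; have [] := D x.
    + by apply: cvg_at_right_filter; exact: Fc.
    + by apply: cvg_at_left_filter; exact: Fc.
  - by move=> x _; rewrite derive1E; have [_ ->] := D x.
have mI k : measurable (I k) by exact: measurable_itv.
rewrite /Jfun.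
(* The minorant is a sum of continuous functions cut off to disjoint intervals; it is measurable
   whatever is known of f along the curve. *)
apply: (@le_trans _ _ (\int[lebesgue_measure]_(t in `[0%R, 1%R])
   \sum_(k < m) ((EFin \o g k) \_ (I k)) t)%E).
  rewrite ge0_integral_sum//=; first last.
  - move=> k t _; rewrite patchE; case: ifP => // _.
    by rewrite lee_fin.
  - move=> k; apply/measurable_restrict => //; first exact: mI.
    apply: measurable_funTS; apply/measurable_EFinP.
    exact: continuous_measurable_fun.
  rewrite mulrC mulr_suml -sumEFin; apply: lee_sum => k _.
  by rewrite -integral_mkcondr setIC setIidl ?gint.
apply: le_integral_nonmeasurable.
  move=> t _; apply: sume_ge0 => k _; rewrite patchE; case: ifP => // _.
  by rewrite lee_fin.
move=> t; rewrite /= in_itv/= => t01.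
have [[k0 Ik0]|nI] := pselect (exists k : 'I_m, I k t); last first.
  rewrite big1 ?lee_fin ?mulr_ge0 ?powR_ge0// => k _.
  by rewrite patchE memNset// => Ik; apply: nI; exists k.
rewrite (bigD1 k0)//= big1 ?adde0; last first.
  move=> k kk0; rewrite patchE memNset// => Ik.
  have /andP[a1 a2] := IP _ _ Ik0; have /andP[b1 b2] := IP _ _ Ik.
  have : (k < k0)%N || (k0 < k)%N by rewrite -neq_ltn.
  move=> /orP[] h.
    have : (2 * k)%:R + 2 <= (2 * k0)%:R :> R by rewrite -natrD ler_nat -mulnSr leq_mul2l.
    by lra.
  have : (2 * k0)%:R + 2 <= (2 * k)%:R :> R by rewrite -natrD ler_nat -mulnSr leq_mul2l.
  by lra.
rewrite patchE mem_set//= lee_fin.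
apply: curve_integrand_ge (IP _ _ Ik0) => //.
move=> i Di; rewrite /delta -mulrA mulr_natl mulr2n.
have := eP (k0, i) Di => /= eD.
have : (1 - theta) ^+ 2 * e <= (1 - theta) ^+ 2 * (hi k0 i - lo k0 i) by rewrite ler_pM2l.
have : 0 < (1 - theta) ^+ 2 * (hi k0 i - lo k0 i) by rewrite mulr_gt0.
by lra.
Qed.

Lemma path_le_Jbar : ((\sum_(k < m) C k)%:E <= Jbar f)%E.
Proof.
apply/lee_mul01Pr; first by rewrite lee_fin sumr_ge0.
move=> r /andP[r0 r1].
(* For this [theta] the loss 2 (1 - theta)^2 equals (1 - r)^2 / 2, which is at most 1 - r. *)
have th : 2^-1 <= (1 + r) / 2 < 1 by apply/andP; split; lra.
have [g ga gJ] := path_Jfun_ge th.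
apply: le_trans (le_trans gJ _); last by apply: ereal_sup_ubound; exists g.
rewrite -EFinM lee_fin ler_wpM2r ?sumr_ge0//.
have -> : 1 - (1 + r) / 2 = (1 - r) / 2 by field.
by nra.
Qed.

End FixedPath.
End PathBound.

(** * The outer measure leb_d on boxes *)

Section BoxMeasure.
Variables (R : realType) (d : nat).
Notation pt := 'rV[R]_d.
Implicit Types (a b s x y u v : pt) (A B : set pt).

Lemma borel_d_box a b : borel_d (box a b).
Proof. by apply: sub_sigma_algebra; exists a, b. Qed.

Lemma borel_dI A B : borel_d A -> borel_d B -> borel_d (A `&` B).
Proof.
exact: (@measurableI _ (g_sigma_algebraType [set B : set pt | exists a b, B = box a b])).
Qed.

Lemma borel_dC A : borel_d A -> borel_d (~` A).
Proof.
exact: (@measurableC _ (g_sigma_algebraType [set B : set pt | exists a b, B = box a b])).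
Qed.

Lemma borel_dT : borel_d (setT : set pt).
Proof.
exact: (@measurableT _ (g_sigma_algebraType [set B : set pt | exists a b, B = box a b])).
Qed.

Lemma borel_d_bigcup (F : nat -> set pt) :
  (forall k, borel_d (F k)) -> borel_d (\bigcup_k F k).
Proof.
move=> FP.
apply: (@bigcupT_measurable _ (g_sigma_algebraType [set B : set pt | exists a b, B = box a b])).
exact: FP.
Qed.

Lemma boxvol_ge0 a b : 0 <= boxvol a b.
Proof. by apply: prodr_ge0 => i _; rewrite le_max lexx orbT. Qed.

Lemma leb_d_le_cover A (a b : nat -> pt) : A `<=` \bigcup_k box (a k) (b k) ->
  (leb_d A <= \sum_(0 <= k <oo) (boxvol (a k) (b k))%:E)%E.
Proof. by move=> Aab; apply: ereal_inf_lbound; exists a, b. Qed.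

Lemma leb_d_ge0 A : (0 <= leb_d A)%E.
Proof.
apply: le_ereal_inf_tmp => _ [a [b [_ ->]]].
by apply: nneseries_ge0 => k _ _; rewrite lee_fin boxvol_ge0.
Qed.

Lemma leb_d_mono A B : A `<=` B -> (leb_d A <= leb_d B)%E.
Proof.
move=> AB; apply: le_ereal_inf => _ [a [b [Bab ->]]]; exists a, b; split=> //.
exact: subset_trans Bab.
Qed.

Hypothesis d_gt0 : (0 < d)%N.

Lemma boxvol_empty : boxvol (0 : pt) 0 = 0.
Proof. by rewrite /boxvol (bigD1 (Ordinal d_gt0))//= mxE subrr maxxx mul0r. Qed.

Lemma leb_d_setU_box A a b :
  (leb_d (A `|` box a b) <= leb_d A + (boxvol a b)%:E)%E.
Proof.
rewrite -leeBlDr//; apply: le_ereal_inf_tmp => _ [u [v [Auv ->]]].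
rewrite leeBlDr// addeC.
pose u' k := if k is k'.+1 then u k' else a; pose v' k := if k is k'.+1 then v k' else b.
apply: le_trans (@leb_d_le_cover _ u' v' _) _.
  move=> x [/Auv[k _ uvx]|abx]; first by exists k.+1.
  by exists 0%N.
rewrite nneseries_recl//=; last by move=> k _; rewrite lee_fin boxvol_ge0.
rewrite leeD2l// -nneseries_addn//; last by move=> k; rewrite lee_fin boxvol_ge0.
by under eq_eseriesr do rewrite addn1.
Qed.

Lemma leb_d_set0 : leb_d (set0 : set pt) = 0%E.
Proof.
apply/eqP; rewrite eq_le leb_d_ge0 andbT.
apply: le_trans (@leb_d_le_cover _ (fun=> 0) (fun=> 0) (sub0set _)) _.
by rewrite boxvol_empty eseries0.
Qed.

Lemma leb_d_box_le a b : (leb_d (box a b) <= (boxvol a b)%:E)%E.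
Proof. by have := leb_d_setU_box set0 a b; rewrite set0U leb_d_set0 add0e. Qed.

(** The affine map taking the box with lower corner [a] and side lengths [s] onto the unit cube. *)
Definition dil a s x : pt := \row_i ((x ord0 i - a ord0 i) / s ord0 i).

Lemma dil_box a s u v : (forall i, 0 < s ord0 i) ->
  dil a s @^-1` (box u v) =
  box (\row_i (a ord0 i + s ord0 i * u ord0 i)) (\row_i (a ord0 i + s ord0 i * v ord0 i)).
Proof.
move=> s0; apply/seteqP; split=> x /= xP i; have := xP i; rewrite !mxE;
  rewrite ler_pdivlMr// ltr_pdivrMr// lerBrDl ltrBlDl.
all: by rewrite ![s _ _ * _]mulrC.
Qed.

Lemma dil_boxvol a s u v : (forall i, 0 < s ord0 i) ->
  boxvol (\row_i (a ord0 i + s ord0 i * u ord0 i)) (\row_i (a ord0 i + s ord0 i * v ord0 i))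
  = (\prod_i s ord0 i) * boxvol u v.
Proof.
move=> s0; rewrite /boxvol -big_split/=; apply: eq_bigr => i _.
rewrite !mxE maxr_pMr ?mulr0; last exact: ltW.
by congr Num.max; ring.
Qed.

Lemma borel_d_dil a s A : (forall i, 0 < s ord0 i) -> borel_d A ->
  borel_d (dil a s @^-1` A).
Proof.
move=> s0; apply: (@smallest_sub _ _ _ [set A | borel_d (dil a s @^-1` A)]).
  split => [|A0|F].
  - by rewrite /= preimage_set0 -setCT; apply: borel_dC; exact: borel_dT.
  - by rewrite /= setTD preimage_setC; exact: borel_dC.
  - by move=> FP; rewrite /= preimage_bigcup; exact: borel_d_bigcup.
by move=> _ [u [v ->]] /=; rewrite dil_box//; exact: borel_d_box.
Qed.

Lemma leqv_dil a s x y : (forall i, 0 < s ord0 i) ->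
  leqv (dil a s x) (dil a s y) = leqv x y.
Proof.
move=> s0; apply: eq_forallb => i; rewrite !mxE.
by rewrite ler_pM2r ?invr_gt0// lerD2r.
Qed.

Lemma leb_d_dil_le a s A : (forall i, 0 < s ord0 i) ->
  (leb_d (dil a s @^-1` A) <= (\prod_i s ord0 i)%:E * leb_d A)%E.
Proof.
move=> s0; have S0 : 0 < \prod_i s ord0 i by apply: prodr_gt0 => i _; exact: s0.
rewrite muleC -lee_pdivrMr//; apply: le_ereal_inf_tmp => _ [u [v [Auv ->]]].
rewrite lee_pdivrMr// muleC -nneseriesZl; last first.
  by move=> k _; rewrite lee_fin boxvol_ge0.
pose t (w : nat -> pt) k : pt := \row_i (a ord0 i + s ord0 i * w k ord0 i).
apply: le_trans (@leb_d_le_cover _ (t u) (t v) _) _.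
  by move=> x /Auv[k _ xk]; exists k => //; rewrite -dil_box.
apply: lee_nneseries => [k _ _|k _]; first by rewrite lee_fin boxvol_ge0.
by rewrite dil_boxvol.
Qed.

Lemma leb_d_dil a s A : (forall i, 0 < s ord0 i) ->
  leb_d (dil a s @^-1` A) = ((\prod_i s ord0 i)%:E * leb_d A)%E.
Proof.
move=> s0; have S0 : 0 < \prod_i s ord0 i by apply: prodr_gt0 => i _; exact: s0.
apply/eqP; rewrite eq_le leb_d_dil_le//=.
(* The inverse x -> a + s x is again of the form [dil], so the inequality already proved applies to
   it and gives the converse. *)
pose s' : pt := \row_i (s ord0 i)^-1.
pose a' : pt := \row_i (- a ord0 i / s ord0 i).
have s'0 i : 0 < s' ord0 i by rewrite mxE invr_gt0.
have := leb_d_dil_le a' (dil a s @^-1` A) s'0.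
have -> : dil a' s' @^-1` (dil a s @^-1` A) = A.
  rewrite -comp_preimage; suff -> : dil a s \o dil a' s' = id by [].
  apply/funext => x; apply/rowP => i; rewrite !mxE /=.
  by have := s0 i => si; field; rewrite gt_eqF.
have -> : \prod_i s' ord0 i = (\prod_i s ord0 i)^-1.
  by rewrite -prodfV; apply: eq_bigr => i _; rewrite mxE.
by move=> h; rewrite muleC -lee_pdivlMr// muleC.
Qed.

End BoxMeasure.

Section UnitCube.
Variables (R : realType) (d : nat).
Hypothesis d_gt0 : (0 < d)%N.
Notation pt := 'rV[R]_d.
Notation ho := (@unit_cube_ho R d).
Implicit Types (a b s x y u v : pt) (A B : set pt).

Lemma unit_cube_hoE : ho = box 0 (const_mx 1).
Proof. by apply/seteqP; split=> x xP i; have := xP i; rewrite !mxE. Qed.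

Lemma leb_d_setU_boxes A (I : Type) (r : seq I) (u v : I -> pt) :
  (leb_d (A `|` \big[setU/set0]_(i <- r) box (u i) (v i))
   <= leb_d A + (\sum_(i <- r) boxvol (u i) (v i))%:E)%E.
Proof.
elim: r => [|i r IH]; first by rewrite !big_nil setU0 adde0.
rewrite !big_cons setUCA setUC; apply: le_trans (leb_d_setU_box _ _ _) _.
by rewrite EFinD (addeC (boxvol _ _)%:E) addeA; exact: leeD2r.
Qed.

Lemma leb_d_unit_cube A :
  leb_d (A `&` @unit_cube_cl R d) = leb_d (A `&` ho).
Proof.
apply/eqP; rewrite eq_le; apply/andP; split; last first.
  by apply: leb_d_mono => x [Ax xh]; split=> // i; have /andP[-> /ltW] := xh i.
(* The faces x_i = 1 of the closed cube are covered by d slabs, [1, 1 + e') in direction i and [0,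
   2) in the others, each of volume at most e' 2^d = e / d. *)
apply/lee_addgt0Pr => e e0; pose e' := e / (d%:R * 2 ^+ d).
have d0 : 0 < d%:R :> R by rewrite ltr0n.
have e'0 : 0 < e' by rewrite divr_gt0// mulr_gt0// exprn_gt0.
pose u (i : 'I_d) : pt := \row_j (i == j)%:R.
pose v (i : 'I_d) : pt := \row_j (if i == j then 1 + e' else 2).
have uv i : boxvol (u i) (v i) <= e / d%:R.
  have -> : e / d%:R = e' * 2 ^+ d.
    by rewrite /e'; field; rewrite gt_eqF//= gt_eqF.
  rewrite /boxvol (bigD1 i)//= !mxE eqxx addrAC subrr add0r max_l; last exact: ltW.
  rewrite ler_pM2l//; apply: (@le_trans _ _ (\prod_(j < d | j != i) 2)).
    apply: ler_prod => j ji; rewrite !mxE eq_sym (negbTE ji) subr0.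
    by rewrite max_l ?ler0n// lexx.
  rewrite prodr_const; apply: ler_weXn2l; first by lra.
  by rewrite -[leqRHS]card_ord max_card.
apply: (@le_trans _ _ (leb_d ((A `&` ho) `|` \big[setU/set0]_(i < d) box (u i) (v i)))).
  apply: leb_d_mono => x [Ax xc].
  have [xh|] := pselect (ho x); first by left.
  move=> /existsNP[i xi]; right; rewrite (bigD1 i)//=.
  left => j; have /andP[xj0 xj1] := xc j; rewrite !mxE.
  have [ij|_] := eqVneq i j; last by rewrite xj0 (le_lt_trans xj1)// ltr1n.
  subst j; move: xi; rewrite xj0 /= => /negP; rewrite -leNgt => ->.
  by rewrite (le_lt_trans xj1)// ltrDl.
apply: le_trans (leb_d_setU_boxes _ _ _ _) _.
rewrite leeD2l// lee_fin; apply: le_trans (ler_sum _ (fun i _ => uv i)) _.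
by rewrite sumr_const card_ord -[leLHS]mulr_natr divfK// gt_eqF.
Qed.

(** A nondegenerate box is a dilated unit cube, so one constant governs all boxes; that it equals 1
    is shown in [leb_d_ho]. *)
Lemma leb_d_box_unit a b :
  leb_d (box a b) = ((boxvol a b)%:E * leb_d ho)%E.
Proof.
have [/forallP ab|/forallPn[i abi]] := boolP [forall i, a ord0 i < b ord0 i].
  pose s : pt := \row_i (b ord0 i - a ord0 i).
  have s0 i : 0 < s ord0 i by rewrite mxE subr_gt0.
  have -> : boxvol a b = \prod_i s ord0 i.
    by apply: eq_bigr => i _; rewrite mxE max_l// subr_ge0 ltW.
  rewrite -(leb_d_dil a)// unit_cube_hoE dil_box//; congr (leb_d (box _ _)).
    by apply/rowP => i; rewrite !mxE mulr0 addr0 ord1.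
  by apply/rowP => i; rewrite !mxE mulr1 addrC subrK ord1.
rewrite -leNgt in abi.
have -> : box a b = set0.
  by rewrite -subset0 => x /(_ i)/andP[ax /(le_lt_trans ax)]; rewrite ltNge abi.
by rewrite (leb_d_set0 R d_gt0)// /boxvol (bigD1 i)//= max_r ?subr_le0// !mul0r mul0e.
Qed.

End UnitCube.

(** * Law of a sample point inside a cell *)

Section CellLaw.
Variables (R : realType) (d L : nat) (f : 'rV[R]_d -> R).
Hypotheses (d_gt0 : (0 < d)%N) (L_gt0 : (0 < L)%N).
Hypothesis f_ge0 : forall x, 0 <= f x.
Notation pt := 'rV[R]_d.
Notation ho := (@unit_cube_ho R d).
Notation index := {ffun 'I_d -> 'I_L}.
Implicit Types (alpha beta : index) (x a b : pt) (A B : set pt).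

Definition upper_corner alpha : pt := \row_i (((alpha i)%:R + 1) / L%:R).

Lemma cellE alpha : cell alpha = box (corner R alpha) (upper_corner alpha).
Proof.
have L0 : 0 < L%:R :> R by rewrite ltr0n.
apply/seteqP; split=> x xP.
  move=> i; have [_] := xP i; rewrite !mxE.
  by rewrite ler_pdivrMr// ltr_pdivlMr// mulrC.
by apply: cell_between => // i; have := xP i; rewrite !mxE.
Qed.

Lemma cell_inj alpha beta x : cell alpha x -> cell beta x -> alpha = beta.
Proof.
move=> xa xb; apply/ffunP => i; apply/val_inj/eqP; rewrite eqn_leq.
have [_ /andP[a1 a2]] := xa i; have [_ /andP[b1 b2]] := xb i.
by apply/andP; split; rewrite -ltnS -(ltr_nat R) -natr1;
  [exact: le_lt_trans a1 b2|exact: le_lt_trans b1 a2].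
Qed.

Lemma pc_integral_cell alpha A : A `<=` cell alpha ->
  pc_integral L f A = ((f (corner R alpha))%:E * leb_d A)%E.
Proof.
move=> Aa; rewrite /pc_integral (bigD1 alpha)//= (setIidl Aa) big1 ?adde0//.
move=> beta ba; have -> : A `&` cell beta = set0.
  rewrite -subset0 => x [/Aa xa xb]; move: ba.
  by rewrite (cell_inj xa xb) eqxx.
by rewrite (leb_d_set0 R d_gt0)// mule0.
Qed.

Lemma pc_integral_out A : A `&` ho = set0 -> pc_integral L f A = 0%E.
Proof.
move=> A0; rewrite /pc_integral big1// => alpha _.
suff -> : A `&` cell alpha = set0 by rewrite (leb_d_set0 R d_gt0)// mule0.
rewrite -subset0 -A0 => x [Ax xa]; split=> // i.
by have [] := xa i.
Qed.

Lemma cell_vol_gt0 alpha : 0 < boxvol (corner R alpha) (upper_corner alpha).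
Proof.
have L0 : 0 < L%:R :> R by rewrite ltr0n.
apply: prodr_gt0 => i _; rewrite !mxE -mulrBl addrAC subrr add0r.
by rewrite lt_max divr_gt0// ltr01.
Qed.

Variables (dT : measure_display) (T : measurableType dT) (P : probability T R)
  (X : nat -> T -> pt).
Hypothesis f_int : pc_integral L f setT = 1%E.
Hypothesis X_iid : iid_law P X (pc_integral L f).

Lemma leb_d_ho_fin : leb_d ho \is a fin_num.
Proof.
rewrite ge0_fin_numE ?leb_d_ge0//; apply: le_lt_trans (_ : _ <= (boxvol 0 (const_mx 1))%:E)%E _.
  by rewrite unit_cube_hoE; exact: leb_d_box_le.
by rewrite ltry.
Qed.

(** Otherwise every term of the total mass would vanish. The second conjunct is what allows division
    by [leb_d] of the cube in [leb_d_ho]. *)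
Lemma exists_cell_pos : exists alpha, 0 < f (corner R alpha) /\ (0 < leb_d ho)%E.
Proof.
apply/not_existsP => H; have := f_int; rewrite /pc_integral big1.
  by move=> /eqP; rewrite lt_eqF.
move=> alpha _; rewrite setTI cellE leb_d_box_unit//.
have [fa|fa] := ltP 0 (f (corner R alpha)); last first.
  have f0 : f (corner R alpha) = 0 by apply/eqP; rewrite eq_le fa f_ge0.
  by rewrite f0 mul0e.
have [l0|l0] := ltP 0%E (leb_d ho); first by case: (H alpha).
suff -> : leb_d ho = 0%E by rewrite !mule0.
by apply/eqP; rewrite eq_le l0 leb_d_ge0.
Qed.

(* The law of the sample makes leb_d countably additive on Borel subsets of a
   cell of positive density, which replaces the usual compactness argument. *)
Lemma leb_d_ho : leb_d ho = 1%E.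
Proof.
have [alpha [fa l0]] := exists_cell_pos.
have [mX _ lawX] := X_iid.
pose v := boxvol (corner R alpha) (upper_corner alpha).
have v0 : 0 < v := cell_vol_gt0 alpha.
pose th := fine (leb_d ho); have thE : leb_d ho = th%:E by rewrite fineK// leb_d_ho_fin.
have th0 : 0 < th by rewrite -lte_fin -thE.
(* Pulled back by [X 0], the cell has probability f v th, while a cover gives at most f th times its
   total volume. The common positive factor cancels, so every cover has volume at least v; as the
   cell itself has [leb_d] equal to v th, this forces th >= 1. *)
have lecover : (v%:E <= leb_d (cell alpha))%E.
  apply: le_ereal_inf_tmp => _ [a [b [ab ->]]].
  have mB k : borel_d (box (a k) (b k) `&` cell alpha).
    by apply: borel_dI; rewrite ?cellE; exact: borel_d_box.
  have : (P (X 0 @^-1` cell alpha) <=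
      \sum_(0 <= k <oo) P (X 0 @^-1` (box (a k) (b k) `&` cell alpha)))%E.
    apply: measure_sigma_subadditive => //.
    - by move=> k; apply: mX.
    - by apply: mX; rewrite cellE; exact: borel_d_box.
    - by move=> w wa; have [k _ kw] := ab _ wa; exists k.
  rewrite lawX; last by rewrite cellE; exact: borel_d_box.
  rewrite (@pc_integral_cell alpha)// {1}cellE leb_d_box_unit// thE => le1.
  have le2 : ((f (corner R alpha) * (v * th))%:E <=
      (f (corner R alpha) * th)%:E * \sum_(0 <= k <oo) (boxvol (a k) (b k))%:E)%E.
    rewrite EFinM EFinM; apply: le_trans le1 _.
    rewrite -nneseriesZl; last by move=> k _; rewrite lee_fin boxvol_ge0.
    apply: lee_nneseries => [k _ _|k _]; first exact: measure_ge0.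
    rewrite lawX// (@pc_integral_cell alpha); last by move=> x [].
    rewrite EFinM -muleA lee_pmul2l// -EFinM mulrC EFinM -thE -leb_d_box_unit//.
    by apply: leb_d_mono => x [].
  rewrite -(@lee_pmul2l _ (f (corner R alpha) * th)%:E)//.
    by rewrite -EFinM -mulrA (mulrC th).
  by rewrite lte_fin mulr_gt0.
apply/eqP; rewrite eq_le; apply/andP; split.
  rewrite unit_cube_hoE; apply: le_trans (leb_d_box_le d_gt0 _ _) _.
  rewrite lee_fin /boxvol big1// => i _.
  by rewrite !mxE subr0 max_l.
move: lecover; rewrite cellE leb_d_box_unit// thE -EFinM !lee_fin.
by rewrite -[leLHS]mulr1 ler_pM2l.
Qed.

(** The product form encodes conditioning: given that the point falls in the box, its rescaled
    position is uniform. *)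
Lemma law_in_box alpha (a b : pt) i A : (forall j, a ord0 j < b ord0 j) ->
  box a b `<=` cell alpha -> borel_d A ->
  P (X i @^-1` (box a b `&` dil a (b - a) @^-1` A)) =
  ((f (corner R alpha) * boxvol a b)%:E * uniform_law A)%E.
Proof.
move=> ab aba mA; have [mX _ lawX] := X_iid.
have s0 j : 0 < (b - a) ord0 j by rewrite !mxE subr_gt0.
have mB : borel_d (box a b `&` dil a (b - a) @^-1` A).
  by apply: borel_dI; [exact: borel_d_box|exact: borel_d_dil].
rewrite lawX// (@pc_integral_cell alpha); last by move=> x [/aba].
have -> : box a b `&` dil a (b - a) @^-1` A = dil a (b - a) @^-1` (A `&` ho).
  rewrite preimage_setI setIC; congr (_ `&` _).
  rewrite unit_cube_hoE dil_box//; congr box.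
    by apply/rowP => j; rewrite !mxE ord1; ring.
  by apply/rowP => j; rewrite !mxE ord1; ring.
rewrite leb_d_dil// /uniform_law leb_d_unit_cube// muleA -EFinM; congr ((_ * _)%:E * _)%E.
by apply: eq_bigr => j _; rewrite !mxE max_l// subr_ge0 ltW.
Qed.

End CellLaw.

(** * Points falling in a box *)

Section Hits.
Variables (R : realType) (d : nat) (T : Type) (X : nat -> T -> 'rV[R]_d).
Variables (B : set 'rV[R]_d) (phi : 'rV[R]_d -> 'rV[R]_d).
Notation pt := 'rV[R]_d.
Implicit Types (A : nat -> set pt) (w : T).

Fixpoint hits (n : nat) w : seq pt :=
  if n is n'.+1 then
    if X n' w \in B then rcons (hits n' w) (X n' w) else hits n' w
  else [::].

Lemma hitsE n w : hits n w = [seq x <- [seq X i w | i <- iota 0 n] | x \in B].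
Proof.
elim: n => [//|n IH].
have -> : iota 0 n.+1 = rcons (iota 0 n) n by rewrite -[n.+1]addn1 iotaD cats1.
by rewrite map_rcons filter_rcons -IH.
Qed.

Lemma size_hits_le n w : (size (hits n w) <= n)%N.
Proof.
by elim: n => //= n IH; case: ifP => _; [rewrite size_rcons ltnS|exact: leqW].
Qed.

Lemma hits_prefix m n w : (m <= n)%N -> prefix (hits m w) (hits n w).
Proof.
elim: n => [|n IH]; first by rewrite leqn0 => /eqP->; exact: prefix_refl.
rewrite leq_eqVlt => /predU1P[->|]; first exact: prefix_refl.
rewrite ltnS => /IH mn /=; case: ifP => // _.
exact: prefix_trans mn (prefix_rcons _ _).
Qed.

Lemma nth_hits m n w k : (k < size (hits m w))%N -> (k < size (hits n w))%N ->
  nth 0 (hits m w) k = nth 0 (hits n w) k.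
Proof.
wlog mn : m n / (m <= n)%N.
  by move=> H km kn; have [mn|/ltnW nm] := leqP m n; [exact: H|apply/esym/H].
by move=> km _; have /prefixP[s ->] := hits_prefix w mn; rewrite nth_cat km.
Qed.

(* The rescaled k-th point in B; the junk value is phi 0 when fewer than k + 1
   points ever fall in B. *)
Definition hit_point (k : nat) w : pt :=
  phi (nth 0 (hits (xget 0%N [set n | (k < size (hits n w))%N]) w) k).

Lemma hit_pointE n w k : (k < size (hits n w))%N ->
  hit_point k w = phi (nth 0 (hits n w) k).
Proof.
move=> kn; congr phi; apply: nth_hits => //.
by apply: (xgetPex 0%N (P := [set n | (k < size (hits n w))%N])); exists n.
Qed.

Lemma hit_point_default w k : (forall n, (size (hits n w) <= k)%N) ->
  hit_point k w = phi 0.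
Proof. by move=> H; rewrite /hit_point nth_default. Qed.

Lemma map_hit_point n w :
  [seq hit_point k w | k <- iota 0 (size (hits n w))] = map phi (hits n w).
Proof.
apply: (@eq_from_nth _ 0); first by rewrite !size_map size_iota.
move=> i; rewrite size_map size_iota => ni.
by rewrite (nth_map 0%N) ?size_iota// nth_iota// (nth_map 0)// (hit_pointE ni).
Qed.

(** The recursion peels off the latest point, which is independent of the event one stage earlier;
    [hit_eventP] gives the direct description. *)
Fixpoint hit_event (n m : nat) A : set T :=
  match n, m with
  | 0%N, 0%N => setT
  | 0%N, _.+1 => set0
  | n'.+1, 0%N => hit_event n' 0 A `&` X n' @^-1` (~` B)
  | n'.+1, m'.+1 => (hit_event n' m'.+1 A `&` X n' @^-1` (~` B)) `|`
     (hit_event n' m' A `&` X n' @^-1` (B `&` phi @^-1` (A m')))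
  end.

Lemma hit_eventP n m A w : hit_event n m A w <->
  size (hits n w) = m /\ (forall k, (k < m)%N -> A k (phi (nth 0 (hits n w) k))).
Proof.
elim: n m => [[|m]|n IH [|m]] /=.
- by split=> // _; split.
- by split=> [//|[]].
- split=> [[/IH[s0 _] /= nB]|[]]; first by rewrite memNset.
  case: ifP => [|XB s0 _]; first by rewrite size_rcons.
  by split; [apply/IH; split|move=> /= XnB; rewrite mem_set in XB].
- split.
    move=> [[/IH[sm AP] /= nB]|[/IH[sm AP] /= [XB XA]]]; first by rewrite memNset.
    rewrite mem_set// size_rcons sm; split=> // k; rewrite ltnS leq_eqVlt nth_rcons sm.
    by move=> /predU1P[->|km]; rewrite ?ltnn ?eqxx// km; exact: AP.
  move=> []; case: ifPn => [/set_mem XB|XB sm AP].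
    rewrite size_rcons => -[sm] AP; right; split; last first.
      by split=> //=; have := AP m (ltnSn m); rewrite nth_rcons sm ltnn eqxx.
    apply/IH; split=> // k km; have := AP k (leqW km).
    by rewrite nth_rcons sm km.
  by left; split; [apply/IH|move=> /= XnB; rewrite mem_set in XB].
Qed.

Lemma hit_event_unionE (D : pred nat) n A :
  \big[setU/set0]_(m < n.+1 | D m) hit_event n m A =
  [set w | D (size (hits n w)) /\
     forall k, (k < size (hits n w))%N -> A k (hit_point k w)].
Proof.
apply/seteqP; split=> w.
  elim/big_ind: _ => // [S1 S2 H1 H2 [/H1|/H2]//|m Dm /hit_eventP[sm AP]] /=.
  rewrite sm; split=> // k km.
  by rewrite (hit_pointE (n := n)) ?sm//; exact: AP.
move=> [Dw AP]; have sn : (size (hits n w) < n.+1)%N by rewrite ltnS size_hits_le.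
rewrite (bigD1 (Ordinal sn))//=; left; apply/hit_eventP; split=> // k kw.
by rewrite -hit_pointE//; exact: AP.
Qed.

End Hits.

(** * Joint law and number of the points in a box *)

Section HitLaw.
Variables (R : realType) (d : nat) (dT : measure_display) (T : measurableType dT).
Variables (P : probability T R) (X : nat -> T -> 'rV[R]_d).
Variables (mu : set 'rV[R]_d -> \bar R).
Variables (B : set 'rV[R]_d) (phi : 'rV[R]_d -> 'rV[R]_d).
Variables (p : R) (v : set 'rV[R]_d -> R).
Notation pt := 'rV[R]_d.
Hypothesis X_iid : iid_law P X mu.
Hypothesis mB : borel_d B.
Hypothesis mphi : forall A, borel_d A -> borel_d (phi @^-1` A).
Hypothesis p_gt0 : 0 < p.
Hypothesis lawB : forall i A, borel_d A ->
  P (X i @^-1` (B `&` phi @^-1` A)) = (p * v A)%:E.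
Hypothesis vT : v setT = 1.
Implicit Types (A C : nat -> set pt).

Notation hits := (hits X B).
Notation hit_point := (hit_point X B phi).
Notation hit_event := (hit_event X B phi).

Let mX i (A : set pt) : borel_d A -> measurable (X i @^-1` A).
Proof. by have [H _ _] := X_iid; exact: H. Qed.

Let mBphi (A : set pt) : borel_d A -> borel_d (B `&` phi @^-1` A).
Proof. by move=> mA; apply: borel_dI => //; exact: mphi. Qed.

Lemma prob_in i : P (X i @^-1` B) = p%:E.
Proof.
have := lawB i (@borel_dT R d).
by rewrite preimage_setT setIT vT mulr1.
Qed.

Lemma prob_notin i : P (X i @^-1` (~` B)) = (1 - p)%:E.
Proof. by rewrite -preimage_setC probability_setC ?prob_in//; exact: mX. Qed.

Lemma prob_p_le1 : p <= 1.
Proof. by rewrite -lee_fin -(prob_in 0) probability_le1//; exact: mX. Qed.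

Lemma v_ge0 (A : set pt) : borel_d A -> 0 <= v A.
Proof. by move=> mA; rewrite -(pmulr_rge0 _ p_gt0) -lee_fin -(lawB 0 mA) measure_ge0. Qed.

Lemma v_le1 (A : set pt) : borel_d A -> v A <= 1.
Proof.
move=> mA; rewrite -(ler_pM2l p_gt0) mulr1 -lee_fin -(lawB 0 mA) -(prob_in 0).
by apply: le_measure; rewrite ?inE; [by apply: mX; exact: mBphi|exact: mX|by move=> w []].
Qed.

Lemma indep_cons n (S : seq nat) (D : set pt) C : uniq S -> n \notin S ->
  borel_d D -> (forall i, borel_d (C i)) ->
  P (X n @^-1` D `&` \bigcap_(i in [set` S]) X i @^-1` C i) =
  (P (X n @^-1` D) * P (\bigcap_(i in [set` S]) X i @^-1` C i))%E.
Proof.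
move=> uS nS mD mC; have [_ indep _] := X_iid.
pose C' i := if i == n then D else C i.
have SC : {in S, C =1 C'}.
  by move=> i iS; rewrite /C' ifN//; apply: contraNneq nS => <-.
have mC' i : borel_d (C' i) by rewrite /C'; case: ifP.
have -> : \bigcap_(i in [set` S]) X i @^-1` C i =
    \bigcap_(i in [set` S]) X i @^-1` C' i.
  by apply: eq_bigcapr => i /= iS; rewrite SC.
have -> : X n @^-1` D `&` \bigcap_(i in [set` S]) X i @^-1` C' i =
    \bigcap_(i in [set` (n :: S)]) X i @^-1` C' i.
  apply/seteqP; split=> w.
    move=> [Dw Cw] i /=; rewrite inE => /predU1P[->|]; last exact: Cw.
    by rewrite /C' eqxx.
  move=> H; split=> [|i /= iS]; last by apply: H; rewrite /= inE iS orbT.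
  by have := H n; rewrite /= mem_head /C' eqxx; apply.
rewrite indep//; last by rewrite /= nS.
by rewrite big_cons {1}/C' eqxx -indep.
Qed.

Lemma measurable_hit_event n m A : (forall k, borel_d (A k)) ->
  measurable (hit_event n m A).
Proof.
move=> mA; elim: n m => [[|m]|n IH [|m]] /=; first exact: measurableT.
- exact: measurable0.
- by apply: measurableI => //; apply: mX; exact: borel_dC.
- apply: measurableU; apply: measurableI => //; apply: mX; first exact: borel_dC.
  exact: mBphi.
Qed.

(** The binomial probability without p^m: those factors are spread over the product of the
    [p * v (A k)]. *)
Definition binom_weight (n m : nat) : R := 'C(n, m)%:R * (1 - p) ^+ (n - m).

(** The constraints [C] on later points make the induction work: the point [X n] peeled off at stage
    n+1 becomes one more later constraint at stage n. *)
Lemma hit_event_indep n m A (S : seq nat) C : (forall k, borel_d (A k)) ->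
  uniq S -> {in S, forall i, (n <= i)%N} -> (forall i, borel_d (C i)) ->
  P (hit_event n m A `&` \bigcap_(i in [set` S]) X i @^-1` C i) =
  ((binom_weight n m * \prod_(k < m) (p * v (A k)))%:E *
   P (\bigcap_(i in [set` S]) X i @^-1` C i))%E.
Proof.
move=> mA; elim: n m S C => [|n IH] m S C uS Sn mC.
  case: m => [|m] /=; rewrite /binom_weight.
    by rewrite setTI bin0 subn0 expr0 big_ord0 !mulr1 mul1e.
  by rewrite set0I measure0 bin0n !mul0r mul0e.
have mF : measurable (\bigcap_(i in [set` S]) X i @^-1` C i).
  by apply: fin_bigcap_measurable => // i _; exact: mX.
have nS : n \notin S by apply/negP => /Sn; rewrite ltnn.
have step m' (D : set pt) : borel_d D ->
    P (hit_event n m' A `&` X n @^-1` D `&` \bigcap_(i in [set` S]) X i @^-1` C i) =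
    ((binom_weight n m' * \prod_(k < m') (p * v (A k)))%:E * (P (X n @^-1` D) *
     P (\bigcap_(i in [set` S]) X i @^-1` C i)))%E.
  move=> mD; rewrite -indep_cons//.
  pose C' i := if i == n then D else C i.
  have mC' i : borel_d (C' i) by rewrite /C'; case: ifP.
  have E : X n @^-1` D `&` \bigcap_(i in [set` S]) X i @^-1` C i =
      \bigcap_(i in [set` (n :: S)]) X i @^-1` C' i.
    apply/seteqP; split=> w.
      move=> [Dw Cw] i /=; rewrite inE /C' => /predU1P[->|iS]; first by rewrite eqxx.
      by rewrite ifN; [exact: Cw|apply: contraNneq nS => <-].
    move=> H; split=> [|i /= iS]; first by have := H n; rewrite /= mem_head /C' eqxx; apply.
    have := H i; rewrite /= inE iS orbT /C' ifN; first by apply.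
    by apply: contraNneq nS => <-.
  rewrite -setIA E IH//; first by rewrite /= nS.
  by move=> i; rewrite inE => /predU1P[->//|/Sn/ltnW].
case: m => [|m] /=.
  rewrite step; last exact: borel_dC.
  by rewrite prob_notin muleA -EFinM /binom_weight !bin0 !subn0 !big_ord0 exprSr !mulr1 mulrA.
set F := \bigcap_(i in _) _ in step mF *.
pose E0 := hit_event n m.+1 A `&` X n @^-1` (~` B) `&` F.
pose E1 := hit_event n m A `&` X n @^-1` (B `&` phi @^-1` A m) `&` F.
have -> : P ((hit_event n m.+1 A `&` X n @^-1` (~` B) `|`
    hit_event n m A `&` X n @^-1` (B `&` phi @^-1` A m)) `&` F) = (P E0 + P E1)%E.
  rewrite setIUl; apply: measureU.
  - apply: measurableI => //; apply: measurableI; first exact: measurable_hit_event.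
    by apply: mX; exact: borel_dC.
  - apply: measurableI => //; apply: measurableI; first exact: measurable_hit_event.
    by apply: mX; exact: mBphi.
  - by rewrite -subset0 => w [[[_ /= nB] _] [[_ [/= yB _]] _]].
rewrite (step _ _ (borel_dC mB)) (step _ _ (mBphi (mA m))).
rewrite prob_notin lawB// !muleA -!EFinM -muleDl//; last exact: fin_num_measure.
rewrite -EFinD; congr (_%:E * _)%E.
rewrite big_ord_recr/= /binom_weight binS natrD subSS (mulrDl _ _ (_ ^+ (n - m))).
(* For n <= m the truncated subtraction spoils the identity of exponents, but then the binomial
   coefficient is 0. *)
have -> : 'C(n, m.+1)%:R * (1 - p) ^+ (n - m) =
    'C(n, m.+1)%:R * ((1 - p) ^+ (n - m.+1) * (1 - p)) :> R.
  have [nm|mn] := leqP n m; first by rewrite bin_small// !mul0r.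
  by rewrite -exprSr subnSK.
ring.
Qed.

Lemma prob_hit_event n m A : (forall k, borel_d (A k)) ->
  P (hit_event n m A) = (binom_weight n m * \prod_(k < m) (p * v (A k)))%:E.
Proof.
have n0 : {in [::], forall i, (n <= i)%N} by [].
move=> mA; have := @hit_event_indep n m A [::] (fun=> setT) mA isT n0 (fun=> @borel_dT R d).
have -> : [set` [::]] = set0 :> set nat by apply/seteqP; split.
by rewrite bigcap_set0 setIT probability_setT mule1.
Qed.

Lemma hit_event_union_law (D : pred nat) n A : (forall k, borel_d (A k)) ->
  P [set w | D (size (hits n w)) /\
     forall k, (k < size (hits n w))%N -> A k (hit_point k w)] =
  (\sum_(m < n.+1 | D m) binom_weight n m * \prod_(k < m) (p * v (A k)))%:E.
Proof.
move=> mA; rewrite -hit_event_unionE.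
transitivity (\sum_(m < n.+1 | D m) P (hit_event n m A))%E; last first.
  by rewrite -sumEFin; apply: eq_bigr => m _; rewrite prob_hit_event.
apply: measure_bigsetU_ord => [m|]; first exact: measurable_hit_event.
apply/trivIsetP => i j _ _ ij; rewrite -subset0 => w [/hit_eventP[si _] /hit_eventP[sj _]].
by move: ij; rewrite -val_eqE /= -si -sj eqxx.
Qed.

Lemma measurable_hit_event_union (D : pred nat) n A : (forall k, borel_d (A k)) ->
  measurable [set w | D (size (hits n w)) /\
     forall k, (k < size (hits n w))%N -> A k (hit_point k w)].
Proof.
move=> mA; rewrite -hit_event_unionE.
by apply: bigsetU_measurable => m _; exact: measurable_hit_event.
Qed.

Lemma size_hits_setE (D : pred nat) n : [set w | D (size (hits n w))] =
  [set w | D (size (hits n w)) /\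
     forall k, (k < size (hits n w))%N -> setT (hit_point k w)].
Proof. by apply/seteqP; split=> [w Dw|w []]. Qed.

Lemma measurable_size_hits (D : pred nat) n : measurable [set w | D (size (hits n w))].
Proof.
rewrite size_hits_setE; apply: (measurable_hit_event_union D n (A := fun=> setT)) => _.
exact: borel_dT.
Qed.

Lemma size_hits_law (D : pred nat) n : P [set w | D (size (hits n w))] =
  (\sum_(m < n.+1 | D m) binom_weight n m * p ^+ m)%:E.
Proof.
rewrite size_hits_setE (hit_event_union_law _ _ (A := fun=> setT)); last first.
  by move=> _; exact: borel_dT.
congr (_%:E); apply: eq_bigr => m _.
by rewrite vT mulr1 prodr_const card_ord.
Qed.

Lemma binom_weight_ge0 n m : 0 <= binom_weight n m.
Proof. by rewrite mulr_ge0 ?ler0n// exprn_ge0// subr_ge0 prob_p_le1. Qed.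

(* Chernoff's bound: rho is the exponential tilt. *)
Lemma chernoff_hits (D : pred nat) n (rho kappa : R) : 0 <= rho -> 0 < kappa ->
  (forall m, D m -> kappa <= rho ^+ m) ->
  (P [set w | D (size (hits n w))] <= ((1 - p + p * rho) ^+ n / kappa)%:E)%E.
Proof.
move=> rho0 k0 kD; rewrite size_hits_law lee_fin ler_pdivlMr// exprDn mulr_suml.
rewrite big_mkcond /=; apply: ler_sum => m _.
have wE : (1 - p) ^+ (n - m) * (p * rho) ^+ m *+ 'C(n, m) =
    binom_weight n m * p ^+ m * rho ^+ m.
  by rewrite /binom_weight -mulr_natl exprMn; ring.
have w0 : 0 <= binom_weight n m * p ^+ m.
  by rewrite mulr_ge0 ?binom_weight_ge0// exprn_ge0// ltW.
rewrite wE; case: ifPn => [Dm|_]; last by rewrite mulr_ge0// exprn_ge0.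
by rewrite ler_wpM2l// kD.
Qed.

Lemma few_hits_le n k :
  (P [set w | (size (hits n w) <= k)%N] <= (2 ^+ k * (1 - p / 2) ^+ n)%:E)%E.
Proof.
(* Tilting by 1/2 weights each outcome with m <= k hits by at least 2^-k, and the resulting base 1 -
   p/2 is below 1. *)
have := @chernoff_hits (fun m => (m <= k)%N) n 2^-1 (2 ^- k).
rewrite invrK (mulrC (_ ^+ n)).
have -> : 1 - p + p * 2^-1 = 1 - p / 2 by field.
apply; rewrite ?invr_gt0 ?exprn_gt0//.
move=> m mk; rewrite -exprVn; apply: ler_wiXn2l => //; lra.
Qed.

Lemma measurable_hit_point k (A : set pt) : borel_d A ->
  measurable (hit_point k @^-1` A).
Proof.
move=> mA; pose A' j := if j == k then A else setT.
have mA' j : borel_d (A' j) by rewrite /A'; case: ifP => // _; exact: borel_dT.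
(* Where more than k hits occur, some finite stage determines the point; elsewhere it is the
   constant [phi 0]. Both parts are countable combinations of hit events. *)
have -> : hit_point k @^-1` A =
  \bigcup_n [set w | (k < size (hits n w))%N /\
     forall j, (j < size (hits n w))%N -> A' j (hit_point j w)] `|`
  (~` (\bigcup_n [set w | (k < size (hits n w))%N]) `&` [set w | A (phi 0)]).
  apply/seteqP; split=> w /=.
    move=> Aw; have [[n kn]|nk] := pselect (exists n, (k < size (hits n w))%N).
      left; exists n => //; split=> // j _.
      by rewrite /A'; case: eqP => [->|].
    right; split; first by move=> [n _ kn]; apply: nk; exists n.
    rewrite -(@hit_point_default _ _ _ X B phi w k)// => n.
    by rewrite leqNgt; apply/negP => kn; apply: nk; exists n.
  move=> [[n _ [kn AP]]|[nk A0]]; first by have := AP k kn; rewrite /A' eqxx.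
  rewrite hit_point_default// => n.
  by rewrite leqNgt; apply/negP => kn; apply: nk; exists n.
apply: measurableU.
  by apply: bigcupT_measurable => n; exact: (measurable_hit_event_union (fun m => (k < m)%N)).
apply: measurableI.
  by apply/measurableC/bigcupT_measurable => n; exact: (measurable_size_hits (fun m => (k < m)%N)).
have [A0|A0] := pselect (A (phi 0)).
  by have -> : [set w : T | A (phi 0)] = setT by apply/seteqP; split.
by have -> : [set w : T | A (phi 0)] = set0 by apply/seteqP; split.
Qed.

Lemma few_hits_vanish k (e : R) : 0 < e ->
  exists n, (P [set w | (size (hits n w) <= k)%N] <= e%:E)%E.
Proof.
move=> e0; have p1 := prob_p_le1.
have p0 := p_gt0.
have z1 : `|1 - p / 2| < 1.
  by rewrite ltr_norml; apply/andP; split; lra.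
have /cvgr0Pnorm_lt/(_ _ e0)[n _ nP] := @cvg_geometric R (2 ^+ k) _ z1.
exists n; apply: le_trans (few_hits_le n k) _; rewrite lee_fin.
apply: ltW; apply: le_lt_trans (nP n _); first exact: ler_norm.
by rewrite /= leqnn.
Qed.

(** For each n, the event is exactly independent of having at least m hits among the first n points,
    because the product factors out of every term of the binomial sum. The probability of the
    missing case tends to 0. *)
Lemma hit_points_joint m A : (forall k, borel_d (A k)) ->
  P (\bigcap_(k in `I_m) hit_point k @^-1` A k) = (\prod_(k < m) v (A k))%:E.
Proof.
move=> mA; set G := \bigcap_(k in _) _; set pi := \prod_(k < m) _.
have mG : measurable G.
  by apply: fin_bigcap_measurable => [|k _]; [exact: finite_II|exact: measurable_hit_point].
have pi01 : 0 <= pi <= 1.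
  rewrite prodr_ge0/=; last by move=> k _; exact: v_ge0.
  rewrite -[leRHS](@big1_eq _ _ *%R 'I_m (index_enum _) xpredT).
  by apply: ler_prod => k _; rewrite v_ge0// v_le1.
(* Hits after the first m are left unconstrained and contribute the factor [v setT = 1]. *)
pose A' k := if (k < m)%N then A k else setT.
have mA' k : borel_d (A' k) by rewrite /A'; case: ifP => // _; exact: borel_dT.
pose H n := [set w | (m <= size (hits n w))%N].
have mH n : measurable (H n) by exact: (measurable_size_hits (fun j => (m <= j)%N)).
have GH n : P (G `&` H n) = (pi%:E * P (H n))%E.
  have -> : G `&` H n = [set w | (m <= size (hits n w))%N /\
      forall k, (k < size (hits n w))%N -> A' k (hit_point k w)].
    apply/seteqP; split=> w /=.
      by move=> [Gw Hw]; split=> // k _; rewrite /A'; case: ifP => // km; exact: Gw.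
    move=> [Hw AP]; split=> // k /= km.
    by have := AP k (leq_trans km Hw); rewrite /A' km.
  rewrite (hit_event_union_law (fun j => (m <= j)%N))// (size_hits_law (fun j => (m <= j)%N)).
  rewrite -EFinM mulr_sumr; congr (_%:E); apply: eq_bigr => j mj.
  have -> : pi = \prod_(k < j) v (A' k).
    rewrite /pi (big_ord_widen j (fun k => v (A k)))// big_mkcond/=.
    by apply: eq_bigr => k _; rewrite /A'; case: ifP.
  by rewrite big_split/= prodr_const card_ord; ring.
have CH (e : R) : 0 < e -> exists n, (P (~` H n) <= e%:E)%E.
  move=> /(few_hits_vanish m)[n nP]; exists n; apply: le_trans nP.
  apply: le_measure; rewrite ?inE; [exact: measurableC| |].
    exact: (measurable_size_hits (fun j => (j <= m)%N)).
  by move=> w /= /negP; rewrite -ltnNge => /ltnW.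
have finP (E : set T) : measurable E -> P E = (fine (P E))%:E.
  by move=> mE; rewrite fineK// fin_num_measure.
rewrite (finP _ mG); congr (_%:E); apply/eqP; rewrite eq_le.
move: pi01 => /andP[pi0 pi1].
apply/andP; split; apply/ler_addgt0Pr => e e0; have [n nP] := CH e e0.
- rewrite -lee_fin -finP// EFinD; apply: (@le_trans _ _ (P (G `&` H n) + P (~` H n))%E).
    apply: le_trans (measureU2 _ _ _).
    + apply: le_measure; rewrite ?inE//.
        by apply: measurableU; [exact: measurableI|exact: measurableC].
      by move=> w Gw; have [Hw|Hw] := pselect (H n w); [left|right].
    + exact: measurableI.
    + exact: measurableC.
  apply: leeD => //; rewrite GH -[leRHS]mule1.
  by apply: lee_wpmul2l; rewrite ?lee_fin// probability_le1.
- rewrite -lerBlDr -lee_fin -finP//; apply: (@le_trans _ _ (P (G `&` H n))); last first.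
    by apply: le_measure; rewrite ?inE//; exact: measurableI.
  rewrite GH; move: nP; rewrite probability_setC// (finP _ (mH n)) -EFinM -EFinB !lee_fin.
  move: (fine _) => h he.
  by nra.
Qed.

Lemma hit_points_iid (nu : set pt -> \bar R) :
  (forall A : set pt, borel_d A -> nu A = (v A)%:E) -> iid_law P hit_point nu.
Proof.
move=> nuE.
have law1 k (A : set pt) : borel_d A -> P (hit_point k @^-1` A) = (v A)%:E.
  move=> mA; pose A' j := if j == k then A else setT.
  have mA' j : borel_d (A' j) by rewrite /A'; case: ifP => // _; exact: borel_dT.
  have := @hit_points_joint k.+1 A' mA'.
  have Ak : A' k = A by rewrite /A' eqxx.
  rewrite big_ord_recr/= Ak big1 ?mul1r => [<-|j _]; last first.
    by rewrite /A' ltn_eqF.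
  congr (P _); apply/seteqP; split=> w.
    by move=> Aw j /= _; rewrite /A'; case: eqP => [->|].
  by move=> /(_ k (ltnSn k)); rewrite /A' eqxx.
split.
- by move=> k A mA; exact: measurable_hit_point.
- move=> S A uS mA; pose m := (\max_(i <- S) i).+1.
  have Sm i : i \in S -> (i < m)%N.
    by move=> iS; rewrite ltnS; apply: leq_bigmax_seq.
  (* The index set is padded to an initial segment, without constraint off [S]. *)
  pose A' j := if j \in S then A j else setT.
  have mA' j : borel_d (A' j) by rewrite /A'; case: ifP => // _; exact: borel_dT.
  have -> : \bigcap_(i in [set` S]) hit_point i @^-1` A i =
      \bigcap_(k in `I_m) hit_point k @^-1` A' k.
    apply/seteqP; split=> w Hw i /= iP; first by rewrite /A'; case: ifP => // iS; exact: Hw.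
    by have := Hw i (Sm i iP); rewrite /A' iP.
  rewrite hit_points_joint//.
  transitivity (\prod_(i <- S) (v (A i)))%:E; last first.
    by rewrite -prodEFin; apply: eq_bigr => i _; rewrite law1.
  congr (_%:E); rewrite -(big_mkord xpredT (fun k => v (A' k))).
  transitivity (\prod_(0 <= k < m | k \in S) v (A k)).
    by rewrite big_mkcond [RHS]big_mkcond; apply: eq_bigr => k _; rewrite /A'; case: ifP.
  rewrite -big_filter; apply: perm_big; apply: uniq_perm => //.
    by rewrite filter_uniq// iota_uniq.
  move=> i; rewrite mem_filter mem_index_iota /=.
  by case: (boolP (i \in S)) => // /Sm.
- by move=> k A mA; rewrite nuE// law1.
Qed.

Lemma many_hits_le n (e : R) : 0 < e <= 1 ->
  (P [set w | ((p + e) * n%:R <= (size (hits n w))%:R)%R] <=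
   (expR (- (e ^+ 2 / 8)) ^+ n)%:E)%E.
Proof.
(* After the estimates below the exponent per point is at most 2 h^2 - h e; its minimum, at h = e/4,
   is - e^2/8. *)
move=> /andP[e0 e1]; pose h := e / 4.
have h0 : 0 < h by rewrite /h; lra.
have := @chernoff_hits (fun m => (p + e) * n%:R <= m%:R) n (expR h) (expR (h * ((p + e) * n%:R))).
move=> /(_ (expR_ge0 _) (expR_gt0 _)) H; apply: le_trans (H _) _ => [m Dm|].
  by rewrite -expRM_natl ler_expR (mulrC m%:R) ler_pM2l.
rewrite lee_fin ler_pdivrMr ?expR_gt0//.
have -> : h * ((p + e) * n%:R) = (h * (p + e)) * n%:R by ring.
rewrite (mulrC (h * (p + e))) expRM_natl -exprMn -expRD.
have p1 := prob_p_le1.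
have eh := expR_ge0 h.
have le1 : 1 - p + p * expR h <= expR (p * (expR h - 1)).
  by apply: le_trans (expR_ge1Dx _); lra.
apply: lerXn2r; rewrite ?nnegrE ?expR_ge0//.
  by rewrite addr_ge0// ?mulr_ge0//; [rewrite subr_ge0|exact: ltW].
apply: le_trans le1 _; rewrite ler_expR.
(* This is exp(-h) >= 1 - h. It gives exp(h) - 1 - h <= h^2 / (1 - h), hence at most 2 h^2 since h
   <= 1/2. *)
have E : expR h * (1 - h) <= 1.
  have := expR_ge1Dx (- h); rewrite expRN => /(ler_wpM2l eh).
  by rewrite divff ?gt_eqF ?expR_gt0.
have h4 : h <= 4^-1 by rewrite /h; lra.
have hh : 0 <= h ^+ 2 * (1 - 2 * h) by rewrite mulr_ge0 ?sqr_ge0//; lra.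
have E2 : expR h - 1 - h <= 2 * h ^+ 2.
  have h1 : 0 < 1 - h by lra.
  by rewrite -(ler_pM2l h1); move: (expR h) E hh => x; lra.
have -> : - (e ^+ 2 / 8) + h * (p + e) = 2 * h ^+ 2 + h * p by rewrite /h; field.
have h2 : 0 <= h ^+ 2 by rewrite sqr_ge0.
have : p * (expR h - 1 - h) <= 2 * h ^+ 2.
  apply: le_trans (_ : p * (2 * h ^+ 2) <= _); first by rewrite ler_pM2l.
  by rewrite ler_piMl// mulr_ge0.
lra.
Qed.

Lemma ae_hits_le (e : R) : 0 < e <= 1 -> {ae P, forall w, exists n0, forall n,
  (n0 <= n)%N -> (size (hits n w))%:R <= (p + e) * n%:R}.
Proof.
move=> e01; have /andP[e0 e1] := e01.
pose F n := [set w | ((p + e) * n%:R <= (size (hits n w))%:R)%R].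
have mF n : measurable (F n).
  exact: (measurable_size_hits (fun m => (p + e) * n%:R <= m%:R)).
exists (lim_sup_set F); split.
- by apply: bigcap_measurable => // k _; apply: bigcup_measurable => j _.
- apply: lim_sup_set_cvg0 => //.
  pose r := expR (- (e ^+ 2 / 8)).
  have r0 : 0 < r := expR_gt0 _.
  have r1 : r < 1 by rewrite -expR0 ltr_expR oppr_lt0 divr_gt0// exprn_gt0.
  apply: (@le_lt_trans _ _ (1 / (1 - r))%:E); last exact: ltry.
  apply: lime_le; first by apply: is_cvg_nneseries => *; exact: measure_ge0.
  apply: nearW => n; apply: (@le_trans _ _ (\sum_(0 <= k < n) (r ^+ k)%:E)%E).
    by apply: lee_sum => k _; exact: many_hits_le.
  rewrite sumEFin lee_fin; have := @geometric_le_lim R n 1 r ler01 r0.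
  rewrite gtr0_norm// => /(_ r1); apply: le_trans.
  by rewrite /series/=; apply: ler_sum => k _; rewrite /geometric/= mul1r.
- move=> w /= nw n _; apply: contrapT => nF; apply: nw; exists n => k nk.
  by rewrite leNgt; apply/negP => /ltW kF; apply: nF; exists k.
Qed.

End HitLaw.

(** * Longest chain in a box *)

Section RootInequalities.
Variables (R : realType) (d : nat).
Hypothesis d_gt0 : (0 < d)%N.
Implicit Types x y : R.

Lemma exprD_ge x y n : (0 < n)%N -> 0 <= x -> 0 <= y ->
  x ^+ n + y ^+ n <= (x + y) ^+ n.
Proof.
case: n => // n _ x0 y0; elim: n => [|n IH]; first by rewrite !expr1.
rewrite [leRHS]exprS; apply: le_trans (_ : (x + y) * (x ^+ n.+1 + y ^+ n.+1) <= _); last first.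
  by rewrite ler_wpM2l// addr_ge0.
rewrite mulrDl !mulrDr -!exprS.
by apply: lerD; rewrite ?lerDl ?lerDr mulr_ge0// exprn_ge0.
Qed.

Lemma powR_invK x : 0 <= x -> (x `^ d%:R^-1) ^+ d = x.
Proof.
move=> x0; rewrite -powR_mulrn ?powR_ge0// -powRrM mulVf ?powRr1//.
by rewrite pnatr_eq0 -lt0n.
Qed.

Lemma powR_invD_le x y : 0 <= x -> 0 <= y ->
  (x + y) `^ d%:R^-1 <= x `^ d%:R^-1 + y `^ d%:R^-1.
Proof.
move=> x0 y0; rewrite -[leRHS](powR_inv_exp d_gt0) ?addr_ge0 ?powR_ge0//.
apply: ler_powR_inv; first exact: addr_ge0.
by rewrite -{1}(powR_invK x0) -{1}(powR_invK y0) exprD_ge// powR_ge0.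
Qed.

Lemma prodrD_le (I : finType) (x : I -> R) (e : R) : 0 <= e ->
  (forall i, 0 <= x i) -> (forall i, x i + e <= 1) ->
  \prod_i (x i + e) <= \prod_i x i + #|I|%:R * e.
Proof.
move=> e0 x0 x1.
(* The increment of a factor is multiplied by the other factors; that their product is at most 1 has
   to be carried through the induction. *)
have H (r : seq I) : \prod_(i <- r) (x i + e) <= \prod_(i <- r) x i + (size r)%:R * e /\
    \prod_(i <- r) (x i + e) <= 1.
  elim: r => [|i r [IH1 IH2]]; first by rewrite !big_nil mul0r addr0.
  have r0 : 0 <= \prod_(i <- r) x i by exact: prodr_ge0.
  have r1 : 0 <= \prod_(i <- r) (x i + e).
    by apply: prodr_ge0 => j _; rewrite addr_ge0.
  have s0 : 0 <= (size r)%:R * e by rewrite mulr_ge0.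
  have := x0 i; have := x1 i; rewrite !big_cons /= -natr1.
  move: (x i) (\prod_(j <- r) _) (\prod_(j <- r) _) ((size r)%:R) IH1 IH2 r0 r1 s0.
  move=> xi A C s; nra.
have [] := H (index_enum I); rewrite -[#|I|]size_enum_ord.
by rewrite size_enum_ord cardE enumT.
Qed.

Lemma natr_powR_large x : exists n0, forall n, (n0 <= n)%N -> x <= n%:R `^ d%:R^-1.
Proof.
pose y := Num.max x 0; have y0 : 0 <= y by rewrite le_max lexx orbT.
exists (Num.truncn (y ^+ d)).+1 => n nP.
apply: (@le_trans _ _ y); first by rewrite le_max lexx.
rewrite -(powR_inv_exp d_gt0 y0); apply: ler_powR_inv; first exact: exprn_ge0.
apply: ltW; rewrite -truncn_lt_nat//; exact: exprn_ge0.
Qed.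

End RootInequalities.

Section ChainsInBox.
Variables (R : realType) (d L : nat) (f : 'rV[R]_d -> R) (c : R).
Variables (dT : measure_display) (T : measurableType dT) (P : probability T R).
Variable X : nat -> T -> 'rV[R]_d.
Hypotheses (d_gt0 : (0 < d)%N) (L_gt0 : (0 < L)%N).
Hypothesis f_ge0 : forall x, 0 <= f x.
Hypothesis f_int : pc_integral L f setT = 1%E.
Hypothesis c_cd : is_cd d c.
Hypothesis X_iid : iid_law P X (pc_integral L f).
Notation pt := 'rV[R]_d.
Variables (alpha : {ffun 'I_d -> 'I_L}) (a b : pt).
Hypothesis ab : forall j, a ord0 j < b ord0 j.
Hypothesis ab_cell : box a b `<=` cell alpha.

Let p := f (corner R alpha) * boxvol a b.

Let boxvol_gt0 : 0 < boxvol a b.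
Proof. by apply: prodr_gt0 => i _; rewrite lt_max subr_gt0 ab. Qed.

Lemma uniform_law_fin (A : set pt) : uniform_law A = (fine (uniform_law A))%:E.
Proof.
rewrite fineK// ge0_fin_numE ?leb_d_ge0//.
apply: (@le_lt_trans _ _ (leb_d (@unit_cube_ho R d))).
  by rewrite /uniform_law leb_d_unit_cube//; apply: leb_d_mono => x [].
by rewrite (leb_d_ho d_gt0 L_gt0 f_ge0 f_int X_iid) ltry.
Qed.

(** The sign of c comes along because the rescaled hits form an actual uniform sample, for which c
    is the limit of nonnegative numbers. *)
Lemma ae_chains_in_box_pos : 0 < f (corner R alpha) ->
  {ae P, forall w, 0 <= c /\ forall eta : R, 0 < eta -> exists n0, forall n, (n0 <= n)%N ->
    n%:R `^ (- d%:R^-1) * (ell (hits X (box a b) n w))%:R <= c * p `^ d%:R^-1 + eta}.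
Proof.
move=> fa.
have p_gt0 : 0 < p by rewrite mulr_gt0.
have s0 j : 0 < (b - a) ord0 j by rewrite !mxE subr_gt0.
pose v (A : set pt) := fine (uniform_law A).
have lawB i A : borel_d A ->
    P (X i @^-1` (box a b `&` dil a (b - a) @^-1` A)) = (p * v A)%:E.
  move=> mA; rewrite (law_in_box d_gt0 X_iid i ab ab_cell mA).
  by rewrite [in RHS]EFinM /v -uniform_law_fin.
have vT : v setT = 1.
  rewrite /v /uniform_law leb_d_unit_cube// setTI.
  by rewrite (leb_d_ho d_gt0 L_gt0 f_ge0 f_int X_iid).
have mB : borel_d (box a b) by exact: borel_d_box.
have mphi A : borel_d A -> borel_d (dil a (b - a) @^-1` A) by exact: borel_d_dil.
pose U := hit_point X (box a b) (dil a (b - a)).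
have U_iid : iid_law P U (@uniform_law R d).
  by apply: (hit_points_iid X_iid mB mphi p_gt0 lawB vT) => A _; exact: uniform_law_fin.
have aeU := c_cd U_iid.
have aeN : {ae P, forall w, forall j, exists n0, forall n, (n0 <= n)%N ->
    (size (hits X (box a b) n w))%:R <= (p + j.+1%:R^-1) * n%:R}.
  apply: ae_foralln => j; apply: (ae_hits_le X_iid mB mphi p_gt0 lawB vT).
  by rewrite invr_gt0 ltr0n/= invf_le1 ?ltr0n// ler1n.
have p1 : p <= 1 := prob_p_le1 X_iid mB lawB vT.
apply: filterS2 aeU aeN => w cvU hN.
have c0 : 0 <= c.
  rewrite -(cvg_lim _ cvU)//; apply: limr_ge; first exact: cvgP cvU.
  by apply: nearW => n; rewrite mulr_ge0 ?powR_ge0.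
split=> // eta eta0.
(* The final excess is dl (c + p^(1/d) + dl + 1), at most dl (c + 3) since p^(1/d) and dl are at
   most 1. *)
pose dl := Num.min 1 (eta / (c + 3)).
have dl0 : 0 < dl by rewrite lt_min ltr01 divr_gt0//; lra.
have dl1 : dl <= 1 by rewrite ge_min lexx.
have dleta : dl * (c + 3) <= eta by rewrite -ler_pdivlMr; [rewrite ge_min lexx orbT|lra].
have [k0 _ k0P] : \forall n \near \oo, scaled_chain U w n <= c + dl.
  move/cvgrPdist_lt: cvU => /(_ dl dl0); apply: filterS => n; rewrite ltr_distl.
  by move=> /andP[/ltW]; rewrite lerBlDr.
(* Adding 1/(j+1) to p then raises its d-th root by at most dl. *)
pose j := Num.truncn (dl ^+ d)^-1.
have jP : j.+1%:R^-1 <= dl ^+ d.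
  have dd0 : 0 < dl ^+ d by rewrite exprn_gt0.
  rewrite -[leRHS]invrK lef_pV2 ?posrE ?ltr0n ?invr_gt0//.
  by rewrite ltW// -truncn_lt_nat// invr_ge0 ltW.
have [n1 n1P] := hN j.
have [n2 n2P] := natr_powR_large d_gt0 (k0%:R / dl).
exists (maxn n1 (maxn n2 1)) => n; rewrite !geq_max => /and3P[/n1P Nn /n2P nk n0].
set N := size (hits X (box a b) n w) in Nn.
have ellU : (ell (hits X (box a b) n w) <= ell_first U N w)%N.
  by rewrite /ell_first map_hit_point; apply: ell_map_ge => x y; exact: leqv_dil.
(* The number N of hits is bounded only from above. While N <= k0 the limit gives no information,
   but then the chain has at most k0 points, which is at most dl n^(1/d). *)
have ellN : (ell_first U N w)%:R <= k0%:R + (c + dl) * N%:R `^ d%:R^-1.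
  have [Nk|kN] := leqP N k0.
    apply: (@le_trans _ _ k0%:R).
      rewrite ler_nat (leq_trans _ Nk)//; apply: leq_trans (ell_le_size _) _.
      by rewrite size_map size_iota.
    by rewrite lerDl mulr_ge0 ?powR_ge0// addr_ge0// ltW.
  apply: (@le_trans _ _ ((c + dl) * N%:R `^ d%:R^-1)); last by rewrite lerDr.
  have N0 : 0 < N%:R `^ d%:R^-1 :> R by apply: powR_gt0; rewrite ltr0n (leq_ltn_trans _ kN).
  rewrite -ler_pdivrMr// mulrC -powRN.
  by apply: (k0P N); rewrite /= ltnW.
have q0 : 0 < n%:R `^ d%:R^-1 :> R by apply: powR_gt0; rewrite ltr0n.
rewrite powRN mulrC ler_pdivrMr//.
apply: le_trans (_ : k0%:R + (c + dl) * N%:R `^ d%:R^-1 <= _).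
  by apply: le_trans ellN; rewrite ler_nat.
have Nq : N%:R `^ d%:R^-1 <= (p `^ d%:R^-1 + dl) * n%:R `^ d%:R^-1.
  apply: le_trans (ler_powR_inv _ _ Nn) _ => //.
  rewrite powRM ?addr_ge0 ?invr_ge0 ?ler0n//; last exact: ltW.
  rewrite ler_wpM2r ?powR_ge0//; apply: le_trans (powR_invD_le d_gt0 _ _) _.
  - exact: ltW.
  - by rewrite invr_ge0.
  rewrite lerD2l -[leRHS](powR_inv_exp d_gt0 (ltW dl0)).
  by apply: ler_powR_inv; rewrite ?invr_ge0.
have Pp0 : 0 <= p `^ d%:R^-1 := powR_ge0 _ _.
have Pp1 : p `^ d%:R^-1 <= 1.
  apply: (@le_trans _ _ (1 `^ d%:R^-1)); last by rewrite powR1.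
  by apply: ler_powR_inv => //; exact: ltW.
move: nk; rewrite ler_pdivrMr// => nk.
have S1 : (c + dl) * N%:R `^ d%:R^-1 <= (c + dl) * ((p `^ d%:R^-1 + dl) * n%:R `^ d%:R^-1).
  by rewrite ler_wpM2l// addr_ge0// ltW.
have S2 : dl * (c + p `^ d%:R^-1 + dl + 1) <= eta.
  by apply: le_trans dleta; rewrite ler_pM2l//; lra.
move: (p `^ _) (n%:R `^ _) (N%:R `^ _) q0 nk S1 S2 => pd q Nd q0 nk S1 S2.
have : dl * (c + pd + dl + 1) * q <= eta * q by rewrite ler_pM2r.
lra.
Qed.

Lemma ae_chains_in_box : {ae P, forall w, forall eta : R, 0 < eta ->
  exists n0, forall n, (n0 <= n)%N ->
    n%:R `^ (- d%:R^-1) * (ell (hits X (box a b) n w))%:R <= c * p `^ d%:R^-1 + eta}.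
Proof.
have [fa|fa] := ltP 0 (f (corner R alpha)).
  by apply: filterS (ae_chains_in_box_pos fa) => w [].
(* In a cell of density 0 there is no sequence of hits to feed to [is_cd]; almost surely no sample
   point falls in it. *)
have f0 : f (corner R alpha) = 0 by apply/eqP; rewrite eq_le fa f_ge0.
have [mX _ lawX] := X_iid.
have : {ae P, forall w, forall i, ~ box a b (X i w)}.
  apply: ae_foralln => i; exists (X i @^-1` box a b); split.
  - by apply: mX; exact: borel_d_box.
  - have := lawX i _ (borel_d_box a b).
    by rewrite (pc_integral_cell f d_gt0 ab_cell) f0 mul0e.
  - by move=> w /= /contrapT.
apply: filterS => w nB eta eta0; exists 0%N => n _.
have -> : hits X (box a b) n w = [::].
  by elim: n => //= n IH; rewrite memNset.
rewrite (_ : ell _ = 0%N) ?mulr0; last by apply/eqP; rewrite -leqn0 ell_le_size.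
by rewrite /p f0 mul0r powR0 ?mulr0 ?add0r ?ltW// invr_eq0 pnatr_eq0 -lt0n.
Qed.

End ChainsInBox.

(** * Cutting a chain along a grid *)

Section Grid.
Variables (R : realType) (d : nat).
Notation pt := 'rV[R]_d.
Notation ho := (@unit_cube_ho R d).
Implicit Types x y z : pt.

(* The reduction mod N only serves to have a total function. *)
Definition gidx N (N_gt0 : (0 < N)%N) x : {ffun 'I_d -> 'I_N} :=
  [ffun i => Ordinal (ltn_pmod (Num.truncn (N%:R * x ord0 i)) N_gt0)].

Section OneScale.
Variables (N : nat) (N_gt0 : (0 < N)%N).

Let N0 : 0 < N%:R :> R. Proof. by rewrite ltr0n. Qed.

Lemma gidxE x i : ho x -> gidx N_gt0 x i = Num.truncn (N%:R * x ord0 i) :> nat.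
Proof.
move=> /(_ i)/andP[x0 x1]; rewrite ffunE /= modn_small// truncn_lt_nat.
  by rewrite -[ltRHS]mulr1 ltr_pM2l.
by rewrite mulr_ge0// ltW.
Qed.

Lemma gidx_itv x i : ho x ->
  (gidx N_gt0 x i)%:R <= N%:R * x ord0 i < (gidx N_gt0 x i)%:R + 1.
Proof.
move=> xh; rewrite natr1 gidxE//; apply: truncn_itv.
by have /andP[x0 _] := xh i; rewrite mulr_ge0// ltW.
Qed.

Lemma gidx_mono x y i : ho x -> ho y -> leqv x y ->
  (gidx N_gt0 x i <= gidx N_gt0 y i)%N.
Proof.
move=> xh yh /forallP xy; rewrite !gidxE//; apply: le_truncn.
by rewrite ler_pM2l.
Qed.

Lemma cell_gidx x : ho x -> cell (gidx N_gt0 x) x.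
Proof. by move=> xh i; split; [exact: xh|exact: gidx_itv]. Qed.

Definition grid_box (u v : {ffun 'I_d -> 'I_N}) : set pt :=
  box (\row_i ((u i)%:R / N%:R)) (\row_i (((v i)%:R + 1) / N%:R)).

Lemma grid_box_between x y z : ho x -> ho y -> ho z -> leqv x z -> leqv z y ->
  grid_box (gidx N_gt0 x) (gidx N_gt0 y) z.
Proof.
move=> xh yh zh xz zy i; rewrite !mxE ler_pdivrMr// ltr_pdivlMr//.
have /andP[z1 z2] := gidx_itv i zh; rewrite mulrC.
rewrite (le_trans _ z1) ?ler_nat ?gidx_mono//= (lt_le_trans z2)//.
by rewrite lerD2r ler_nat gidx_mono.
Qed.

(** The left side is the box that contains the points, the product is the one the curve crosses. All
    sides are at most 1, so lengthening each of the d sides by 1/N costs at most d/N. *)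
Lemma grid_boxvol_le (u v : {ffun 'I_d -> 'I_N}) : (forall i, (u i <= v i)%N) ->
  boxvol (\row_i ((u i)%:R / N%:R)) (\row_i (((v i)%:R + 1) / N%:R) : pt) <=
  \prod_i ((v i)%:R / N%:R - (u i)%:R / N%:R) + d%:R / N%:R.
Proof.
move=> uv.
have -> : boxvol (\row_i ((u i)%:R / N%:R)) (\row_i (((v i)%:R + 1) / N%:R) : pt) =
    \prod_i ((v i)%:R / N%:R - (u i)%:R / N%:R + N%:R^-1).
  apply: eq_bigr => i _; rewrite !mxE.
  have uvi : (u i)%:R <= (v i)%:R :> R by rewrite ler_nat.
  rewrite max_l; first by rewrite mulrDl mul1r addrAC.
  by rewrite -mulrBl divr_ge0//; lra.
rewrite -[X in X%:R / _](card_ord d); apply: prodrD_le => [|i|i].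
- by rewrite invr_ge0.
- by rewrite -mulrBl divr_ge0// ?subr_ge0 ?ler_nat.
- rewrite -mulrBl -{2}[N%:R^-1]mul1r -mulrDl ler_pdivrMr// mul1r.
  have vN : (v i)%:R + 1 <= N%:R :> R by rewrite natr1 ler_nat.
  by have u0 : 0 <= (u i)%:R :> R by []; lra.
Qed.

End OneScale.

Section TwoScales.
Variables (L M : nat) (L_gt0 : (0 < L)%N) (M_gt0 : (0 < M)%N).

Definition refines (alpha : {ffun 'I_d -> 'I_L}) (u v : {ffun 'I_d -> 'I_(L * M)}) :=
  [forall i, [&& alpha i * M <= u i, u i <= v i & v i < (alpha i).+1 * M]%N].

Let LM_gt0 : (0 < L * M)%N. Proof. by rewrite muln_gt0 L_gt0. Qed.

Lemma gidx_refines alpha x y : ho x -> ho y -> cell alpha x -> cell alpha y ->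
  leqv x y -> refines alpha (gidx LM_gt0 x) (gidx LM_gt0 y).
Proof.
move=> xh yh xa ya xy; apply/forallP => i.
have [/andP[x0 _] /andP[ax _]] := xa i; have [/andP[y0 _] /andP[_ ay]] := ya i.
have M0 : 0 < M%:R :> R by rewrite ltr0n.
apply/and3P; split; last 1 first.
- rewrite gidxE// truncn_lt_nat; last by rewrite mulr_ge0.
  by rewrite !natrM -natr1 mulrAC ltr_pM2r.
- by rewrite gidxE// truncn_ge_nat ?mulr_ge0// !natrM mulrAC ler_pM2r.
- exact: gidx_mono.
Qed.

Lemma refines_lo alpha u v i : refines alpha u v ->
  (alpha i)%:R / L%:R <= (u i)%:R / (L * M)%:R :> R.
Proof.
move=> /forallP/(_ i)/and3P[au _ _].
have L0 : 0 < L%:R :> R by rewrite ltr0n.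
have M0 : 0 < M%:R :> R by rewrite ltr0n.
rewrite natrM invfM mulrA mulrAC ler_pM2r ?invr_gt0// ler_pdivlMr//.
by rewrite -natrM ler_nat.
Qed.

Lemma refines_hi alpha u v i : refines alpha u v ->
  ((v i)%:R + 1) / (L * M)%:R <= ((alpha i)%:R + 1) / L%:R :> R.
Proof.
move=> /forallP/(_ i)/and3P[_ _ va].
have L0 : 0 < L%:R :> R by rewrite ltr0n.
have M0 : 0 < M%:R :> R by rewrite ltr0n.
rewrite natrM invfM mulrA mulrAC ler_pM2r ?invr_gt0// ler_pdivrMr//.
by rewrite !natr1 -natrM ler_nat.
Qed.

Lemma refines_box alpha u v : refines alpha u v -> grid_box u v `<=` cell alpha.
Proof.
move=> auv z zuv; apply: cell_between => // i; have := zuv i; rewrite !mxE.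
move=> /andP[z1 z2]; rewrite (le_trans (refines_lo i auv) z1)/=.
exact: lt_le_trans z2 (refines_hi i auv).
Qed.

Variables (f : pt -> R) (c F eta q : R).
Hypotheses (d_gt0 : (0 < d)%N) (f_ge0 : forall x, 0 <= f x) (f_pc : piecewise_const L f).
Hypotheses (c_ge0 : 0 <= c) (q_ge0 : 0 <= q) (eta_ge0 : 0 <= eta).
Hypothesis fF : forall alpha : {ffun 'I_d -> 'I_L}, f (corner R alpha) <= F.

Let err := (F * (d%:R / (L * M)%:R)) `^ d%:R^-1.

(** Subadditivity of the d-th root separates the volume error from the main term, and [F] makes it
    uniform over the cells. *)
Lemma root_boxvol_le alpha u v : refines alpha u v ->
  (f (corner R alpha) * boxvol (\row_i ((u i)%:R / (L * M)%:R))
     (\row_i (((v i)%:R + 1) / (L * M)%:R) : pt)) `^ d%:R^-1 <=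
  (f (corner R alpha) * \prod_i ((v i)%:R / (L * M)%:R - (u i)%:R / (L * M)%:R)) `^ d%:R^-1
  + err.
Proof.
move=> /forallP auv; have uv i : (u i <= v i)%N by have /and3P[] := auv i.
have dK0 : 0 <= d%:R / (L * M)%:R :> R by rewrite divr_ge0.
have p0 : 0 <= \prod_i ((v i)%:R / (L * M)%:R - (u i)%:R / (L * M)%:R) :> R.
  by apply: prodr_ge0 => i _; rewrite -mulrBl divr_ge0// subr_ge0 ler_nat.
set pr := \prod_i _ in p0 *; set fa := f _; have fa0 : 0 <= fa := f_ge0 _.
apply: (@le_trans _ _ ((fa * pr + fa * (d%:R / (L * M)%:R)) `^ d%:R^-1)).
  apply: ler_powR_inv; first by rewrite mulr_ge0// boxvol_ge0.
  by rewrite -mulrDr ler_wpM2l// grid_boxvol_le.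
apply: le_trans (powR_invD_le d_gt0 (mulr_ge0 fa0 p0) (mulr_ge0 fa0 dK0)) _.
rewrite lerD2l; apply: ler_powR_inv; first exact: mulr_ge0.
by apply: ler_wpM2r => //; exact: fF.
Qed.

(** The deterministic core, for one outcome and one n: [q] stands for n^(-1/d), and the hypothesis
    on boxes is what holds almost surely for large n. [S] depends on the chain, but its bound by
    [Jbar] does not. *)
Lemma chain_count_le (s : seq pt) : {in s, forall x, ho x} ->
  (forall alpha u v, refines alpha u v ->
     q * (ell [seq x <- s | x \in grid_box u v])%:R <=
     c * (f (corner R alpha) * boxvol (\row_i ((u i)%:R / (L * M)%:R))
       (\row_i (((v i)%:R + 1) / (L * M)%:R) : pt)) `^ d%:R^-1 + eta) ->
  exists2 S : R, (S%:E <= Jbar f)%E &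
    q * (ell s)%:R <= c * S + #|{ffun 'I_d -> 'I_L}|%:R * (c * err + eta).
Proof.
move=> s_ho Hq; have [t [ut ts ct <-]] := ell_witness s.
have t_ho x : x \in t -> ho x by move=> /ts/s_ho.
pose cof := gidx L_gt0; pose K := (L * M)%N; pose g := gidx LM_gt0.
pose ta alpha := [seq x <- t | cof x == alpha].
have taP alpha x : x \in ta alpha -> [/\ x \in t, ho x & cell alpha x].
  rewrite mem_filter => /andP[/eqP<- xt]; split=> //; first exact: t_ho.
  by apply: cell_gidx; exact: t_ho.
have cta alpha : chain (ta alpha).
  by move=> x y /taP[xt _ _] /taP[yt _ _]; exact: ct.
have /choice[mnx mnxP] : forall alpha, exists xy : pt * pt, ta alpha != [::] ->
    [/\ xy.1 \in ta alpha, xy.2 \in ta alpha,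
      {in ta alpha, forall x, leqv xy.1 x} & {in ta alpha, forall x, leqv x xy.2}].
  move=> alpha; have [->|a0] := eqVneq (ta alpha) [::]; first by exists (0, 0).
  have [x xa xP] := chain_min (cta alpha) a0.
  by have [y ya yP] := chain_max (cta alpha) a0; exists (x, y).
pose u alpha := g (mnx alpha).1; pose v alpha := g (mnx alpha).2.
pose vis alpha := ta alpha != [::].
have visP alpha : vis alpha -> refines alpha (u alpha) (v alpha).
  move=> /mnxP[xa ya xP _]; have [_ xh xc] := taP _ _ xa; have [_ yh yc] := taP _ _ ya.
  by apply: gidx_refines => //; exact: xP.
pose C alpha := (f (corner R alpha) *
  \prod_i ((v alpha i)%:R / K%:R - (u alpha i)%:R / K%:R)) `^ d%:R^-1.
have count_ta alpha : vis alpha -> q * (size (ta alpha))%:R <= c * C alpha + (c * err + eta).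
  move=> va; rewrite addrA -mulrDr.
  apply: le_trans (_ : c * _ + eta <= _); last first.
    by rewrite lerD2r; apply: ler_wpM2l (root_boxvol_le (visP _ va)).
  apply: le_trans (Hq _ _ _ (visP _ va)); apply: ler_wpM2l => //; rewrite ler_nat.
  apply: chain_le_ell; [exact: filter_uniq| |exact: cta].
  move=> z za; have [zt zh _] := taP _ _ za; rewrite mem_filter ts// andbT.
  have [xa ya xP yP] := mnxP _ va; have [_ xh _] := taP _ _ xa; have [_ yh _] := taP _ _ ya.
  by rewrite mem_set//; apply: grid_box_between => //; [exact: xP|exact: yP].
have size_t : (size t = \sum_(alpha | vis alpha) size (ta alpha))%N.
  have -> : (\sum_(alpha | vis alpha) size (ta alpha) = \sum_alpha size (ta alpha))%N.
    rewrite big_mkcond; apply: eq_bigr => alpha _; rewrite /vis -size_eq0.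
    by case: (size _).
  rewrite /ta; elim: (t) => [|x r IH]; first by rewrite big1.
  rewrite /= IH [in RHS](bigD1 (cof x))//= eqxx /= addSn; congr _.+1.
  rewrite [in LHS](bigD1 (cof x))//=; congr (_ + _)%N.
  by apply: eq_bigr => alpha ax; rewrite eq_sym (negbTE ax).
pose r (alpha beta : {ffun 'I_d -> 'I_L}) := [forall i, (alpha i <= beta i)%N].
have r_anti alpha beta : r alpha beta -> r beta alpha -> alpha = beta.
  move=> /forallP ab /forallP ba; apply/ffunP => i; apply/val_inj/eqP.
  by rewrite eqn_leq ab ba.
have r_leqv alpha beta x y : x \in ta alpha -> y \in ta beta -> leqv x y -> r alpha beta.
  rewrite !mem_filter => /andP[/eqP<- xt] /andP[/eqP<- yt] xy.
  by apply/forallP => i; apply: gidx_mono => //; exact: t_ho.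
have r_total alpha beta : vis alpha -> vis beta -> r alpha beta || r beta alpha.
  move=> /mnxP[xa _ _ _] /mnxP[xb _ _ _].
  have [xt _ _] := taP _ _ xa; have [yt _ _] := taP _ _ xb.
  by have /orP[h|h] := ct _ _ xt yt; apply/orP; [left|right]; exact: r_leqv h.
pose V := sort r [seq alpha <- index_enum {ffun 'I_d -> 'I_L} | vis alpha].
have V_vis alpha : (alpha \in V) = vis alpha.
  by rewrite mem_sort mem_filter mem_index_enum andbT.
have V_uniq : uniq V by rewrite sort_uniq filter_uniq// index_enum_uniq.
have V_sorted : sorted r V.
  (* [r] is total only among visited cells, where points of the chain can be compared. *)
  apply: (sort_sorted_in (P := [pred alpha | vis alpha])).
    by move=> alpha beta; exact: r_total.
  by apply/allP => alpha; rewrite mem_filter => /andP[].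
pose m := size V; pose al k := nth (cof 0) V k.
have al_vis k : (k < m)%N -> vis (al k) by move=> km; rewrite -V_vis mem_nth.
(* After the last box the curve still needs a target above every [hi]; the corner 1 of the cube
   serves. *)
pose lo k i := if (k < m)%N then (u (al k) i)%:R / K%:R else 1 : R.
pose hi k i := (v (al k) i)%:R / K%:R : R.
have K0 : 0 < K%:R :> R by rewrite ltr0n.
have lohi k i : (k < m)%N -> lo k i <= hi k i.
  move=> km; rewrite /lo km ler_pM2r ?invr_gt0// ler_nat.
  by have /forallP/(_ i)/and3P[] := visP _ (al_vis _ km).
have hilo k i : (k < m)%N -> hi k i <= lo k.+1 i.
  move=> km; rewrite /lo; case: ifPn => [k1m|_]; last first.
    by rewrite ler_pdivrMr// mul1r ler_nat ltnW.
  rewrite ler_pM2r ?invr_gt0// ler_nat.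
  have va := al_vis _ km; have vb := al_vis _ k1m.
  have [_ ya _ _] := mnxP _ va; have [xb _ _ _] := mnxP _ vb.
  have [yt yh _] := taP _ _ ya; have [xt xh _] := taP _ _ xb.
  (* If the first point in the next cell lay below the last point in this one, the two cells would
     be ordered both ways and hence coincide, although [V] has no repetition. *)
  apply: gidx_mono => //; have /orP[//|h] := ct _ _ yt xt.
  have rab : r (al k) (al k.+1) by move/(sortedP (cof 0)): V_sorted; apply.
  have ab := r_anti _ _ rab (r_leqv _ _ _ _ xb ya h).
  move/eqP: ab; rewrite nth_uniq//.
  by rewrite -[X in X == _]addn0 -addn1 eqn_add2l.
have al_lo k i : (k < m)%N -> (al k i)%:R / L%:R <= lo k i.
  by move=> km; rewrite /lo km; apply: refines_lo (visP _ (al_vis _ km)).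
have hi_al k i : (k < m)%N -> hi k i <= ((al k i)%:R + 1) / L%:R.
  move=> km; apply: le_trans (refines_hi i (visP _ (al_vis _ km))).
  by rewrite ler_pM2r ?invr_gt0// lerDl.
exists (\sum_(alpha | vis alpha) C alpha).
  have := path_le_Jbar d_gt0 L_gt0 f_ge0 f_pc lohi hilo al_lo hi_al.
  congr (_ <= _)%E; congr (_%:E).
  transitivity (\sum_(k < m) C (al k)).
    apply: eq_bigr => k _; congr ((_ * _) `^ _); apply: eq_bigr => i _.
    by rewrite /hi /lo ltn_ord.
  rewrite -(big_mkord xpredT (fun k => C (al k))) -(big_nth _ xpredT C).
  by rewrite (perm_big _ (permEl (perm_sort _ _))) big_filter.
rewrite size_t natr_sum mulr_sumr mulr_sumr.
apply: le_trans (ler_sum _ (fun alpha va => count_ta alpha va)) _.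
rewrite big_split/= lerD2l sumr_const -[leLHS]mulr_natl.
rewrite ler_wpM2r ?addr_ge0// ?mulr_ge0 ?powR_ge0// ler_nat.
exact: max_card.
Qed.

End TwoScales.
End Grid.

(** * From almost sure bounds on boxes to the upper limit *)

Lemma ae_const (R : realType) (dT : measure_display) (T : measurableType dT)
  (P : probability T R) (Q : Prop) : {ae P, forall w, Q} -> Q.
Proof.
move=> [N [mN PN QN]]; apply: contrapT => nQ.
have : P setT = 0%E by apply: subset_measure0 PN => // w _; exact: QN.
by rewrite probability_setT => /eqP; rewrite onee_eq0.
Qed.

Lemma limn_esup_le_near (R : realType) (u : (\bar R)^nat) (x : \bar R) n0 :
  (forall n, (n0 <= n)%N -> (u n <= x)%E) -> (limn_esup u <= x)%E.
Proof.
move=> ux; apply: ge_ereal_inf; exists (ereal_sup [set u n | n in [set n | (n0 <= n)%N]]).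
  by exists [set n | (n0 <= n)%N] => //; exists n0.
by apply: ge_ereal_sup => _ [n /ux uxn <-].
Qed.

Local Open Scope ereal_scope.

Theorem theorem3p4 (R : realType) (d L : nat) (f : 'rV[R]_d -> R) (c : R)
  (dT : measure_display) (T : measurableType dT) (P : probability T R)
  (X : nat -> T -> 'rV[R]_d) :
  (2 <= d)%N -> (0 < L)%N ->
  (forall x, 0 <= f x)%R ->
  (forall x, ~ unit_cube_ho x -> f x = 0%R) ->
  piecewise_const L f ->
  pc_integral L f setT = 1 ->
  is_cd d c ->
  iid_law P X (pc_integral L f) ->
  {ae P, forall w,
     limn_esup (fun n => (scaled_chain X w n)%:E) <= c%:E * Jbar f}.
Proof.
move=> d_ge2 L_gt0 f_ge0 _ f_pc f_int c_cd X_iid.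
have d_gt0 : (0 < d)%N by exact: ltnW.
(* A cell of positive density supplies the uniform sample that fixes the sign of c. *)
have c_ge0 : (0 <= c)%R.
  have [alpha [fa _]] := exists_cell_pos d_gt0 L_gt0 f_ge0 f_int.
  have ab j : (corner R alpha ord0 j < upper_corner R alpha ord0 j)%R.
    by rewrite !mxE ltr_pM2r ?invr_gt0 ?ltr0n// ltrDl.
  have ab_cell : box (corner R alpha) (upper_corner R alpha) `<=` cell alpha.
    by rewrite -cellE.
  have := ae_chains_in_box_pos d_gt0 L_gt0 f_ge0 f_int c_cd X_iid ab ab_cell fa.
  by move=> H; apply: (@ae_const _ _ _ P); apply: filterS H => w [].
have X_ho : {ae P, forall w, forall i, unit_cube_ho (X i w)}.
  have [mX _ lawX] := X_iid; apply: ae_foralln => i.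
  have mho : borel_d (~` @unit_cube_ho R d).
    by apply: borel_dC; rewrite unit_cube_hoE; exact: borel_d_box.
  exists (X i @^-1` (~` @unit_cube_ho R d)); split=> //; first exact: mX.
  by have := lawX i _ mho; rewrite pc_integral_out// setICl.
pose F := (\sum_(alpha : {ffun 'I_d -> 'I_L}) f (corner R alpha))%R.
have fF (alpha : {ffun 'I_d -> 'I_L}) : (f (corner R alpha) <= F)%R.
  by rewrite /F (bigD1 alpha)//= lerDl sumr_ge0.
have F_ge0 : (0 <= F)%R by exact: sumr_ge0.
pose nC : R := #|{ffun 'I_d -> 'I_L}|%:R.
have nC_ge0 : (0 <= nC)%R by rewrite ler0n.
(* The grid depends on the tolerance, and so does the exceptional null set; countably many
   tolerances suffice. *)
suff H (j : nat) : {ae P, forall w,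
    limn_esup (fun n => (scaled_chain X w n)%:E) <= c%:E * Jbar f + (j.+1%:R^-1)%:E}.
  apply: filterS (ae_foralln H) => w Hw; apply/lee_addgt0Pr => e e0.
  have je : ((Num.truncn e^-1).+1%:R^-1 <= e)%R.
    rewrite -[leRHS]invrK lef_pV2 ?posrE ?ltr0n ?invr_gt0//.
    by rewrite ltW// -truncn_lt_nat// invr_ge0 ltW.
  by apply: le_trans (Hw (Num.truncn e^-1)) _; apply: leeD2l; rewrite lee_fin.
pose e : R := (j.+1%:R^-1)%R; have e0 : (0 < e)%R by rewrite invr_gt0.
(* Each of the nC cells pays c err + eta. With err <= y = eta / (c + 1) this is at most 2 eta, for a
   total of at most e; [M] is taken so large that F d / (L M) <= y^d. The added 1 keeps denominators
   positive. *)
pose eta : R := (e / (2 * (nC + 1)))%R.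
have eta0 : (0 < eta)%R by rewrite divr_gt0// mulr_gt0// ltr_wpDl.
pose y : R := (eta / (c + 1))%R.
have y0 : (0 < y)%R by rewrite divr_gt0// ltr_wpDl.
pose M := (Num.truncn (F * d%:R / y ^+ d)%R).+1.
have M_gt0 : (0 < M)%N by [].
pose err : R := ((F * (d%:R / (L * M)%:R)) `^ d%:R^-1)%R.
have err_y : (err <= y)%R.
  rewrite -(powR_inv_exp d_gt0 (ltW y0)); apply: ler_powR_inv.
    by rewrite mulr_ge0// divr_ge0.
  have yd0 : (0 < y ^+ d)%R by rewrite exprn_gt0.
  rewrite mulrA ler_pdivrMr ?ltr0n ?muln_gt0 ?L_gt0// -ler_pdivrMl// mulrC.
  apply: (@le_trans _ _ M%:R); last by rewrite ler_nat leq_pmull.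
  by rewrite ltW// -truncn_lt_nat// divr_ge0 ?mulr_ge0// ltW.
have nC_err : (nC * (c * err + eta) <= e)%R.
  have cy : (c * err <= eta)%R.
    apply: (@le_trans _ _ ((c + 1) * y)%R); last by rewrite /y mulrC divfK// gt_eqF// ltr_wpDl.
    by apply: ler_pM => //; [exact: powR_ge0|rewrite lerDl].
  apply: (@le_trans _ _ ((nC + 1) * (eta + eta))%R).
    apply: ler_pM => //; last by rewrite lerD2r.
      by apply: addr_ge0; [rewrite mulr_ge0 ?powR_ge0|exact: ltW].
    by rewrite lerDl.
  rewrite /eta le_eqVlt; apply/orP; left; apply/eqP; field.
  by rewrite gt_eqF// ltr_wpDl.
pose bx (uv : {ffun 'I_d -> 'I_(L * M)} * {ffun 'I_d -> 'I_(L * M)}) :=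
  @grid_box R d (L * M) uv.1 uv.2.
pose vol (uv : {ffun 'I_d -> 'I_(L * M)} * {ffun 'I_d -> 'I_(L * M)}) :=
  boxvol (\row_i ((uv.1 i)%:R / (L * M)%:R))%R
    (\row_i (((uv.2 i)%:R + 1) / (L * M)%:R) : 'rV[R]_d)%R.
pose good (au : {ffun 'I_d -> 'I_L} * ({ffun 'I_d -> 'I_(L * M)} * {ffun 'I_d -> 'I_(L * M)})) w :=
  refines au.1 au.2.1 au.2.2 -> exists n0, forall n, (n0 <= n)%N ->
    (n%:R `^ (- d%:R^-1) * (ell (hits X (bx au.2) n w))%:R <=
     c * (f (corner R au.1) * vol au.2) `^ d%:R^-1 + eta)%R.
have ae_good : {ae P, forall w, forall au, good au w}.
  apply: filter_forall => -[alpha uv].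
  have [auv|nauv] := boolP (refines alpha uv.1 uv.2); last first.
    by apply: filterE => w; rewrite /good /= (negbTE nauv).
  have uv_lt i : ((\row_i ((uv.1 i)%:R / (L * M)%:R) : 'rV[R]_d)%R ord0 i <
      (\row_i (((uv.2 i)%:R + 1) / (L * M)%:R) : 'rV[R]_d)%R ord0 i)%R.
    rewrite !mxE ltr_pM2r ?invr_gt0 ?ltr0n ?muln_gt0 ?L_gt0// natr1 ltr_nat ltnS.
    by have /forallP/(_ i)/and3P[] := auv.
  have := ae_chains_in_box d_gt0 L_gt0 f_ge0 f_int c_cd X_iid uv_lt
    (refines_box L_gt0 M_gt0 auv).
  by apply: filterS => w Hw _; exact: Hw.
apply: filterS2 X_ho ae_good => w Xw Hw.
have /choice[n0 n0P] : forall au, exists n0, refines au.1 au.2.1 au.2.2 ->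
    forall n, (n0 <= n)%N ->
    (n%:R `^ (- d%:R^-1) * (ell (hits X (bx au.2) n w))%:R <=
     c * (f (corner R au.1) * vol au.2) `^ d%:R^-1 + eta)%R.
  move=> au; have [auv|nauv] := boolP (refines au.1 au.2.1 au.2.2).
    by have [n0 n0P] := Hw au auv; exists n0.
  by exists 0%N.
apply: (@limn_esup_le_near _ _ _ (\max_au n0 au)) => n nn.
pose s := [seq X i w | i <- iota 0 n].
have s_ho : {in s, forall x, unit_cube_ho x} by move=> _ /mapP[i _ ->].
have Hs alpha u v : refines alpha u v ->
    (n%:R `^ (- d%:R^-1) * (ell [seq x <- s | x \in @grid_box R d _ u v])%:R <=
     c * (f (corner R alpha) * vol (u, v)) `^ d%:R^-1 + eta)%R.
  move=> auv; have := n0P (alpha, (u, v)) auv n; rewrite hitsE; apply.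
  exact: leq_trans (leq_bigmax (alpha, (u, v))) nn.
have [S SJ le_S] := chain_count_le L_gt0 M_gt0 d_gt0 f_ge0 f_pc c_ge0
  (powR_ge0 _ _) (ltW eta0) fF s_ho Hs.
apply: (@le_trans _ _ (c%:E * S%:E + e%:E)).
  rewrite -EFinM -EFinD lee_fin; apply: le_trans le_S _.
  by rewrite lerD2l.
by rewrite leeD2r// lee_wpmul2l.
Qed.
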